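(* Fix $T\in\mathbb{N}$ and $\mathcal{T}=\{t_0,\dots,t_T\}$. Suppose that: (1) for all $t_\ell\in\mathcal{T}$, $f(\cdot;t_\ell)$ and $g(\cdot;t_\ell)$ are twice continuously differentiable and $p$-strongly convex; (2) $\mathcal{X}=\mathcal{X}_1\times\dots\times\mathcal{X}_N$ with each $\mathcal{X}_i\subseteq\mathbb{R}^{n_i}$ non-empty, compact and polyhedral; (3) there are constants $L_t,\Delta,\sigma_\ell>0$ such that, for all $x\in\mathcal{X}$, $y\in\mathcal{Y}$ and all consecutive times, $\|x^*(t_{\ell+1})-x^*(t_\ell)\|\le\sigma_{\ell+1}$, $|J(x,y;t_{\ell+1})-J(x,y;t_\ell)|\le L_t|t_{\ell+1}-t_\ell|$, and $|t_{\ell+1}-t_\ell|\le\Delta$; (4) there are $\kappa_\ell\ge1$ ticks of $k$ while minimizing $J(\cdot,\cdot;t_\ell)$, where $\kappa_\ell=r_\ell B$, $r_\ell\in\mathbb{N}_0$; (5) partial asynchrony holds with constant $B\in\mathbb{N}$. Suppose also that $\frac{2}{B(L_{x,\ell}+L_{y,\ell}\|C\|^2)}\le1$ for all $t_\ell\in\mathcal{T}$. Let $N$ agents execute the asynchronous feedback optimization algorithm with stepsizes $\gamma_\ell\in(0,\gamma_{\max,\ell})$, generating the true network state $\{x(k),y(k)\}$. Then for all $t_\ell\in\mathcal{T}$, $$\alpha(\eta_{\ell-1}+r_\ell B;t_\ell)\le a_\ell\,\rho_\ell^{\,r_\ell-1},\qquad\beta(\eta_{\ell-1}+r_\ell B)\le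 b_\ell\,\rho_\ell^{\,r_\ell-1},\qquad\delta(\eta_{\ell-1}+r_\ell B)\le d_\ell\,\rho_\ell^{\,r_\ell-1},$$ where $\eta_\ell=\sum_{i=0}^\ell\kappa_i$, $\eta_{-1}=0$, and $a_\ell,b_\ell,d_\ell,\rho_\ell\in(0,1),\gamma_{\max,\ell}$ are the explicit constants given in the context.
   Context: **Problem.** $\mathbb{N}=\{1,2,\dots\}$, $\mathbb{N}_0=\mathbb{N}\cup\{0\}$, $[N]=\{1,\dots,N\}$; $\|\cdot\|$ is the Euclidean norm (and induced matrix norm); $\mathrm{diam}(\mathcal{X})=\sup_{x,y\in\mathcal{X}}\|x-y\|$; $\Pi_Z$ is Euclidean projection onto the closed convex set $Z$. There are $N$ agents; $n=\sum_i n_i$, $m=\sum_i m_i$; $C\in\mathbb{R}^{m\times n}$ has column blocks $C=[C_1\ \cdots\ C_N]$, $C_i\in\mathbb{R}^{m\times n_i}$, and row blocks $C_{i*}\in\mathbb{R}^{m_i\times n}$. $\mathcal{Y}=\{Cx:x\in\mathcal{X}\}$. For $f:\mathbb{R}^n\times\mathbb{N}_0\to\mathbb{R}$, $g:\mathbb{R}^m\times\mathbb{N}_0\to\mathbb{R}$, put $J(x,y;t)=f(x;t)+g(y;t)$; the gradient with respect to inputs is $\nabla_xJ(x,y;t)=\nabla_xf(x;t)+C^T\nabla_yg(y;t)$, with block $\nabla_{x_i}J(x,y;t)=\nabla_{x_i}f(x;t)+C_i^T\nabla_yg(y;t)$. Here $x^*(t_\ell)=\arg\min_{x\in\mathcal{X}}f(x;t_\ell)+g(Cx;t_\ell)$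 and $y^*(t_\ell)=Cx^*(t_\ell)$. **Algorithm.** Agent $i$ stores $x^i(k)=(x^i_1(k),\dots,x^i_N(k))$ and $y^i(k)=(y^i_1(k),\dots,y^i_N(k))$, $x^i_j(k)\in\mathbb{R}^{n_j}$, $y^i_j(k)\in\mathbb{R}^{m_j}$. The true state is $x(k)=(x^1_1(k),\dots,x^N_N(k))$, $y(k)=Cx(k)$, $y_i(k)=C_{i*}x(k)$; initially $x^i_i(0)\in\mathcal{X}_i$. Let $\mathcal{K}^i$ (resp. $\mathcal{M}^i$) be the set of times at which agent $i$ computes (resp. measures) and $\mathcal{C}^j_i$ the set of times at which $i$ receives a transmission from $j$. Here $\tau^i_j(k)$ is the time at which agent $j$ originally computed the value $x^i_j(k)$, and $\mu^i_j(k)$ is the time at which agent $j$ originally measured the value $y^i_j(k)$, so $x^i_j(k)=x^j_j(\tau^i_j(k))$ for $j\ne i$ and $y^i_j(k)=C_{j*}x(\mu^i_j(k))$. For $\eta_{\ell-1}\le k<\eta_\ell$ (objective $J(\cdot,\cdot;t_\ell)$ active): $x^i_i(k+1)=\Pi_{\mathcal{X}_i}\big[x^i_i(k)-\gamma_\ell\big(\nabla_{x_i}f(x^i(k);t_\ell)+C_i^T\nabla_yg(y^i(k);t_\ell)\big)\big]$ if $k\in\mathcal{K}^i$, else $x^i_i(k+1)=x^i_i(k)$; $y^i_i(k+1)=y_i(k)$ if $k\in\mathcal{M}^i$, else $y^i_i(k+1)=y^i_i(k)$; for $j\neq i$, $x^i_j$ and $y^i_j$ are replaced by the received (possibly old)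 values of $x^j_j$ and of agent $j$'s measured output (those of times $\tau^i_j(k)$, $\mu^i_j(k)$) if $k\in\mathcal{C}^j_i$, and are unchanged otherwise. **Partial asynchrony** with $B\in\mathbb{N}$: for every $i$ and $k\ge0$, each of $\mathcal{K}^i$ and $\mathcal{M}^i$ contains at least one element of $\{k,\dots,k+B-1\}$; and $\max\{0,k-B+1\}\le\tau^i_j(k)\le k$, $\max\{0,k-B+1\}\le\mu^i_j(k)\le k$ for all $i,j\in[N]$, $k\ge0$. **Error quantities.** $s_i(k)=x^i_i(k+1)-x^i_i(k)$ if $k\in\mathcal{K}^i$, else $0$; $q_i(k)=y^i_i(k+1)-y^i_i(k)$ if $k\in\mathcal{M}^i$, else $0$; $s=(s_1,\dots,s_N)$, $q=(q_1,\dots,q_N)$; $s(\tau)=0$, $q(\tau)=0$ for $\tau<0$. For $\eta_{\ell-1}\le k\le\eta_\ell$: $\alpha(k;t_\ell)=J(x(k),y(k);t_\ell)-J(x^*(t_\ell),y^*(t_\ell);t_\ell)$, $\beta(k)=\sum_{\tau=k-B}^{k-1}\|s(\tau)\|^2$, $\delta(k)=\sum_{\tau=k-B}^{k-1}\|q(\tau)\|^2$. **Constants.** $L_{x,\ell},L_{y,\ell}>0$: upper bounds on $\|\nabla_x^2f(\cdot;t_\ell)\|$ over $\mathcal{X}$ and $\|\nabla_y^2g(\cdot;t_\ell)\|$ over $\mathcal{Y}$ (Lipschitz constants of $\nabla_xf$, $\nabla_yg$). $M_{x,\ell},M_{y,\ell}>0$: upper bounds on $\|\nabla_xf(\cdot;t_\ell)\|$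 over $\mathcal{X}$ and $\|\nabla_yg(\cdot;t_\ell)\|$ over $\mathcal{Y}$. $L_{J,\ell}>0$, $L_\ell>0$: Lipschitz constants of $J(\cdot,\cdot;t_\ell)$ and $\nabla_xJ(\cdot,\cdot;t_\ell)$ on $\mathcal{X}\times\mathcal{Y}$. $\lambda>0$: error-bound constant, i.e. $\|x-x^*(t_\ell)\|\le\lambda\max\{1,\gamma^{-1}\}\|x-\Pi_{\mathcal{X}}[x-\gamma\nabla_xJ(x,Cx;t_\ell)]\|$ for all $x\in\mathcal{X}$, $\gamma>0$, and each $t_\ell$. Writing $L=L_\ell$, $L_x=L_{x,\ell}$, $L_y=L_{y,\ell}$: $$D_\ell=\tfrac12\big(2-\gamma_\ell((1+B)L_x+(1+BN)\|C\|^2L_y)\big),\qquad E_\ell=\tfrac12NB(L_x+L_yN\|C\|^2),$$ $$F_\ell=\tfrac12\Big((1+\lambda^2)\big[36B^3\|C\|^6L^2L_y^2N^2m+72B^3\|C\|^4L^2L_xL_yN^2m+36BL^2L_x^2N^2+36B^3\|C\|^2L^2L_x^2N^2m+36B\|C\|^4L^2L_y^2N^2+18\|C\|^2L_xL_yN+72B\|C\|^2L^2L_xL_yN^2+9\|C\|^4L_y^2N\big]+3B^2\|C\|^6L^2L_y^2N^2m+\|C\|^4\big[72B^3L^2L_yN^2m+6B^2L^2L_xL_yN^2m+6B^2L^2L_yN^2m+3L^2L_y^2N^2+3B^2L_y^2Nm\big]+\|C\|^2\big[96B^3L^2N^2m+72B^3L^2L_xN^2m+72BL^2L_yN^2+60B^3L^2N^2\lambda^2m+18L_yN+8B^2L^2N^2m+6B^2L^2L_xN^2m+6L^2L_xL_yN^2+6L^2L_yN^2+3B^2L^2L_x^2N^2m\big]+3L^2L_x^2N^2+96BL^2N^2+6L^2L_xN^2+8L^2N^2+60BL^2N^2\lambda^2+72BL^2L_xN^2+12L_x^2N+9L_x^2N\lambda^2+18L_xN+15N\lambda^2+24N+2\Big),$$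 $$G_\ell=\tfrac N2\Big((1+\lambda^2)\big[72B^3\|C\|^4L^2L_xL_yNm+72B\|C\|^2L^2L_xL_yN+36B^3\|C\|^6L^2L_y^2Nm+36B^3\|C\|^2L^2L_x^2Nm+36B\|C\|^4L^2L_y^2N+36BL^2L_x^2N\big]+3B^2\|C\|^6L^2L_y^2Nm+\|C\|^4\big[72B^3L^2L_yNm+6B^2L^2L_xL_yNm+6B^2L^2L_yNm+3B^2L_y^2m+3L^2L_y^2N\big]+\|C\|^2\big[96B^3L^2Nm+72B^3L^2L_xNm+72BL^2L_yN+60B^3L^2N\lambda^2m+8B^2L^2Nm+6B^2L^2L_xNm+6L^2L_xL_yN+6L^2L_yN+3B^2L^2L_x^2Nm+BL_yN\big]+96BL^2N+72BL^2L_xN+60BL^2N\lambda^2+8L^2N+6L^2L_xN+3L_x^2+3L^2L_x^2N+BL_x\Big),$$ $$c_\ell=\frac{D_\ell}{2F_\ell+2D_\ell}\in(0,\tfrac12),\qquad\rho_\ell=1-\gamma_\ell c_\ell\in(0,1),\qquad d_\ell=B^2m\|C\|^2b_\ell.$$ For $\ell\ge1$: $b_\ell=B\,\mathrm{diam}(\mathcal{X})^2$ and $$a_\ell=a_{\ell-1}\rho_{\ell-1}^{\,r_{\ell-1}-1}+2\Delta L_t+L_{J,\ell}\sigma_\ell(1+\|C\|)+(M_{x,\ell}+M_{y,\ell}\|C\|)B\,\mathrm{diam}(\mathcal{X})+\frac{8E_\ell(\frac{G_\ell}{F_\ell}+\frac{E_\ell}{D_\ell})F_\ell B^2\mathrm{diam}(\mathcal{X})^2(L_x+L_y\|C\|^2)}{2D_\ell}.$$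 For $\ell=0$: $a_0=\max\big\{L_{J,0}(1+\|C\|)\mathrm{diam}(\mathcal{X}),\ \frac{8E_0(\frac{G_0}{F_0}+\frac{E_0}{D_0})F_0}{D_0}B\,\mathrm{diam}(\mathcal{X})^2\big\}$ and $b_0=\frac{D_0}{8E_0(\frac{G_0}{F_0}+\frac{E_0}{D_0})F_0}a_0$. Finally $$\gamma_{\max,\ell}=\min\Big\{\tfrac{2}{(3N+1)BL_x+(3N^2+1)B\|C\|^2L_y},\ \tfrac{2}{(1+B)L_x+(1+BN)\|C\|^2L_y},\ \tfrac{D_\ell}{E_\ell},\ \big(\tfrac{G_\ell}{F_\ell}+\tfrac{E_\ell}{D_\ell}\big)^{-1},\ \tfrac1{2c_\ell},\ \tfrac{D_\ell}{8F_\ell(\frac{G_\ell}{F_\ell}+\frac{E_\ell}{D_\ell})c_\ell},\ \tfrac{\frac{a_\ell}{b_\ell}+2E_\ell+D_\ell c_\ell-\sqrt{(\frac{a_\ell}{b_\ell}+2E_\ell+D_\ell c_\ell)^2-4D_\ell E_\ell c_\ell}}{2E_\ell c_\ell},\ \tfrac12\Big\}.$$ Some of these constants depend on $\gamma_\ell$; the condition $\gamma_\ell\in(0,\gamma_{\max,\ell})$ means that $\gamma_\ell>0$ is strictly less than each term of the minimum, with the terms evaluated at that $\gamma_\ell$ (in particular $D_\ell>0$).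
   Formalization: The constant L_{y,ℓ} is required to be a Lipschitz constant of ∇_y g(·;t_ℓ) on the product of the block projections of Y (where the agents' mixed-age output copies lie), not only a Hessian bound over Y; with the bound over Y alone the claim fails. *)

(* Defs.v *)
From HB Require Import structures.
From mathcomp Require Import all_boot all_order all_algebra.
From mathcomp Require Import all_classical all_reals all_analysis.

Set Implicit Arguments.
Unset Strict Implicit.
Unset Printing Implicit Defensive.

Import Order.TTheory GRing.Theory Num.Theory.
Import numFieldNormedType.Exports.

Local Open Scope classical_set_scope.
Local Open Scope ring_scope.

Section Euclidean.
Variable R : realType.

(* The library norm on matrices is the max norm, hence these definitions. *)
Definition enorm n (x : 'cV[R]_n) : R := Num.sqrt (\sum_i x i 0 ^+ 2).

Definition opnorm m n (A : 'M[R]_(m, n)) : R :=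
  sup [set enorm (A *m x) | x in [set x : 'cV[R]_n | enorm x <= 1]].

Definition ediam n (X : set 'cV[R]_n) : R :=
  sup [set enorm (p.1 - p.2) | p in X `*` X].

Definition argmin_set (T : Type) (F : T -> R) (A : set T) : set T :=
  [set x | A x /\ forall y, A y -> F x <= F y].

(* [get] picks an arbitrary minimizer, or a default value if there is none. *)
Definition argmin n (F : 'cV[R]_n -> R) (A : set 'cV[R]_n) : 'cV[R]_n :=
  get (argmin_set F A).

Definition euclid_proj n (Z : set 'cV[R]_n) (x : 'cV[R]_n) : 'cV[R]_n :=
  argmin (fun z => enorm (x - z)) Z.

Definition grad n (h : 'cV[R]_n -> R) (x : 'cV[R]_n) : 'cV[R]_n :=
  \col_i 'D_(delta_mx i 0) h x.

Definition hess n (h : 'cV[R]_n -> R) (x : 'cV[R]_n) : 'M[R]_n :=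
  \matrix_(i, j) 'D_(delta_mx j 0) (fun z => grad h z i 0) x.

Definition C2 n (h : 'cV[R]_n -> R) : Prop :=
  [/\ forall x, differentiable h x,
      forall x, differentiable (grad h) x
    & continuous (hess h)].

Definition strongly_convex n (p : R) (h : 'cV[R]_n -> R) : Prop :=
  forall (x y : 'cV[R]_n) (t : R), 0 <= t <= 1 ->
    h (t *: x + (1 - t) *: y) <=
      t * h x + (1 - t) * h y - p / 2 * t * (1 - t) * enorm (x - y) ^+ 2.

Definition polyhedral n (X : set 'cV[R]_n) : Prop :=
  exists q (A : 'M[R]_(q, n)) (b : 'cV[R]_q),
    X = [set x | forall i, (A *m x) i 0 <= b i 0].

Definition lipschitz_const n m (L : R) (A : set 'cV[R]_n)
    (h : 'cV[R]_n -> 'cV[R]_m) : Prop :=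
  forall x x', A x -> A x' -> enorm (h x - h x') <= L * enorm (x - x').

End Euclidean.

Section Network.
Variables (R : realType) (N : nat) (n_ m_ : 'I_N -> nat).

Local Notation n := (\sum_i n_ i)%N.
Local Notation m := (\sum_i m_ i)%N.

Definition prod_set (X_ : forall i, set 'cV[R]_(n_ i)) : set 'cV[R]_n :=
  [set x | forall i, X_ i (submxcol x i)].

Definition outputs (C : 'M[R]_(m, n)) (X : set 'cV[R]_n) : set 'cV[R]_m :=
  [set C *m x | x in X].

(* An agent's copy of the output stacks blocks measured at different times, so
   it need not belong to [outputs C X], only to the product of the projections
   of that set on the blocks. *)
Definition stacked_outputs (C : 'M[R]_(m, n)) (X : set 'cV[R]_n) :
    set 'cV[R]_m :=
  [set y | forall i, exists2 x, X x & submxcol y i = submxcol C i *m x].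

Variables (C : 'M[R]_(m, n)) (X : set 'cV[R]_n).
Variables (f : 'cV[R]_n -> nat -> R) (g : 'cV[R]_m -> nat -> R).

Definition J (x : 'cV[R]_n) (y : 'cV[R]_m) (t : nat) : R := f x t + g y t.

Definition grad_x_J (x : 'cV[R]_n) (y : 'cV[R]_m) (t : nat) : 'cV[R]_n :=
  grad (f ^~ t) x + C^T *m grad (g ^~ t) y.

Definition grad_xi_J (i : 'I_N) (x : 'cV[R]_n) (y : 'cV[R]_m) (t : nat) :
    'cV[R]_(n_ i) :=
  submxcol (grad (f ^~ t) x) i + (submxrow C i)^T *m grad (g ^~ t) y.

Definition xstar (t : nat) : 'cV[R]_n :=
  argmin (fun x => f x t + g (C *m x) t) X.

Definition ystar (t : nat) : 'cV[R]_m := C *m xstar t.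

End Network.

(* [start kappa l] is eta_(l-1), so that eta_l is [start kappa l.+1]. *)
Definition start (kappa : nat -> nat) (l : nat) : nat := (\sum_(i < l) kappa i)%N.

Section Algorithm.
Variables (R : realType) (N : nat) (n_ m_ : 'I_N -> nat).

Local Notation n := (\sum_i n_ i)%N.
Local Notation m := (\sum_i m_ i)%N.

(* [xs i j k] and [ys i j k] are agent i's copies at time k of the decision
   variable and of the output of agent j. *)
Variables (xs : forall i j : 'I_N, nat -> 'cV[R]_(n_ j)).
Variables (ys : forall i j : 'I_N, nat -> 'cV[R]_(m_ j)).

Definition xcopy (i : 'I_N) (k : nat) : 'cV[R]_n := \mxcol_j xs i j k.
Definition ycopy (i : 'I_N) (k : nat) : 'cV[R]_m := \mxcol_j ys i j k.
Definition xtrue (k : nat) : 'cV[R]_n := \mxcol_j xs j j k.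
Definition ytrue (C : 'M[R]_(m, n)) (k : nat) : 'cV[R]_m := C *m xtrue k.

Definition partial_asynchrony (B : nat) (K M : 'I_N -> set nat)
    (tau mu : 'I_N -> 'I_N -> nat -> nat) : Prop :=
  [/\ forall i k, exists2 k', (k <= k' < k + B)%N & K i k',
      forall i k, exists2 k', (k <= k' < k + B)%N & M i k',
      forall i j k, (maxn 0 (k.+1 - B) <= tau i j k <= k)%N
    & forall i j k, (maxn 0 (k.+1 - B) <= mu i j k <= k)%N].

Variables (C : 'M[R]_(m, n)).
Variables (f : 'cV[R]_n -> nat -> R) (g : 'cV[R]_m -> nat -> R).

(* Agent i computes at the times in [K i], measures at the times in [M i] and
   receives from agent j at the times in [Cm j i]; f and g are sampled at the
   times [t 0, .., t T], and [t l] is in force for [kappa l] ticks. *)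
Record feedback_run (X_ : forall i, set 'cV[R]_(n_ i)) (T : nat)
    (t kappa : nat -> nat) (gamma : nat -> R)
    (K M : 'I_N -> set nat) (Cm : 'I_N -> 'I_N -> set nat)
    (tau mu : 'I_N -> 'I_N -> nat -> nat) : Prop := FeedbackRun {
  run_init : forall i, X_ i (xs i i 0%N);
  run_compute : forall l k i, (l <= T)%N ->
    (start kappa l <= k < start kappa l.+1)%N ->
    xs i i k.+1 =
      if k \in K i then
        euclid_proj (X_ i)
          (xs i i k - gamma l *: grad_xi_J C f g i (xcopy i k) (ycopy i k) (t l))
      else xs i i k;
  run_measure : forall k i, (k < start kappa T.+1)%N ->
    ys i i k.+1 = if k \in M i then submxcol (ytrue C k) i else ys i i k;
  run_receive_x : forall k i j, (k < start kappa T.+1)%N -> j != i ->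
    xs i j k.+1 = if k \in Cm j i then xs j j (tau i j k.+1) else xs i j k;
  run_receive_y : forall k i j, (k < start kappa T.+1)%N -> j != i ->
    ys i j k.+1 =
      if k \in Cm j i then submxcol C j *m xtrue (mu i j k.+1) else ys i j k;
  run_delay_x : forall k i j, (k <= start kappa T.+1)%N -> j != i ->
    xs i j k = xs j j (tau i j k);
  run_delay_y : forall k i j, (k <= start kappa T.+1)%N ->
    ys i j k = submxcol C j *m xtrue (mu i j k)
}.

Definition sstep (K : 'I_N -> set nat) (k : nat) : 'cV[R]_n :=
  \mxcol_i (if k \in K i then xs i i k.+1 - xs i i k else 0).

Definition qstep (M : 'I_N -> set nat) (k : nat) : 'cV[R]_m :=
  \mxcol_i (if k \in M i then ys i i k.+1 - ys i i k else 0).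

Definition alpha (X : set 'cV[R]_n) (t : nat) (k : nat) : R :=
  J f g (xtrue k) (ytrue C k) t
  - J f g (xstar C X f g t) (ystar C X f g t) t.

(* Truncated subtraction drops the terms of negative index, which are zero. *)
Definition beta (B : nat) (K : 'I_N -> set nat) (k : nat) : R :=
  \sum_(k - B <= i < k) enorm (sstep K i) ^+ 2.

Definition delta (B : nat) (M : 'I_N -> set nat) (k : nat) : R :=
  \sum_(k - B <= i < k) enorm (qstep M i) ^+ 2.

End Algorithm.

(* [c_C] and [c_diam] stand for the norm of C and the diameter of X, and
   [c_m] for the total dimension of the output. *)
Record constants (R : realType) := Constants {
  c_N : nat; c_B : nat; c_m : nat; c_C : R; c_diam : R;
  c_lam : R; c_Lt : R; c_Delta : R; c_sigma : nat -> R;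
  c_Lx : nat -> R; c_Ly : nat -> R; c_Mx : nat -> R; c_My : nat -> R;
  c_LJ : nat -> R; c_L : nat -> R;
  c_r : nat -> nat; c_gamma : nat -> R
}.

Section Constants.
Variables (R : realType) (P : constants R).

Local Notation N := ((c_N P)%:R : R).
Local Notation B := ((c_B P)%:R : R).
Local Notation m := ((c_m P)%:R : R).
Local Notation c := (c_C P).
Local Notation diam := (c_diam P).
Local Notation lam := (c_lam P).

Definition Dl (l : nat) : R :=
  2^-1 * (2 - c_gamma P l *
    ((1 + B) * c_Lx P l + (1 + B * N) * c ^+ 2 * c_Ly P l)).

Definition El (l : nat) : R :=
  2^-1 * N * B * (c_Lx P l + c_Ly P l * N * c ^+ 2).

Definition Fl (l : nat) : R :=
  let L := c_L P l in let Lx := c_Lx P l in let Ly := c_Ly P l in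
  2^-1 * (
    (1 + lam ^+ 2) * (
      36 * B ^+ 3 * c ^+ 6 * L ^+ 2 * Ly ^+ 2 * N ^+ 2 * m
      + 72 * B ^+ 3 * c ^+ 4 * L ^+ 2 * Lx * Ly * N ^+ 2 * m
      + 36 * B * L ^+ 2 * Lx ^+ 2 * N ^+ 2
      + 36 * B ^+ 3 * c ^+ 2 * L ^+ 2 * Lx ^+ 2 * N ^+ 2 * m
      + 36 * B * c ^+ 4 * L ^+ 2 * Ly ^+ 2 * N ^+ 2
      + 18 * c ^+ 2 * Lx * Ly * N
      + 72 * B * c ^+ 2 * L ^+ 2 * Lx * Ly * N ^+ 2
      + 9 * c ^+ 4 * Ly ^+ 2 * N)
    + 3 * B ^+ 2 * c ^+ 6 * L ^+ 2 * Ly ^+ 2 * N ^+ 2 * m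
    + c ^+ 4 * (
      72 * B ^+ 3 * L ^+ 2 * Ly * N ^+ 2 * m
      + 6 * B ^+ 2 * L ^+ 2 * Lx * Ly * N ^+ 2 * m
      + 6 * B ^+ 2 * L ^+ 2 * Ly * N ^+ 2 * m + 3 * L ^+ 2 * Ly ^+ 2 * N ^+ 2
      + 3 * B ^+ 2 * Ly ^+ 2 * N * m)
    + c ^+ 2 * (
      96 * B ^+ 3 * L ^+ 2 * N ^+ 2 * m
      + 72 * B ^+ 3 * L ^+ 2 * Lx * N ^+ 2 * m + 72 * B * L ^+ 2 * Ly * N ^+ 2
      + 60 * B ^+ 3 * L ^+ 2 * N ^+ 2 * lam ^+ 2 * m + 18 * Ly * N
      + 8 * B ^+ 2 * L ^+ 2 * N ^+ 2 * m
      + 6 * B ^+ 2 * L ^+ 2 * Lx * N ^+ 2 * m + 6 * L ^+ 2 * Lx * Ly * N ^+ 2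
      + 6 * L ^+ 2 * Ly * N ^+ 2 + 3 * B ^+ 2 * L ^+ 2 * Lx ^+ 2 * N ^+ 2 * m)
    + 3 * L ^+ 2 * Lx ^+ 2 * N ^+ 2 + 96 * B * L ^+ 2 * N ^+ 2
    + 6 * L ^+ 2 * Lx * N ^+ 2 + 8 * L ^+ 2 * N ^+ 2
    + 60 * B * L ^+ 2 * N ^+ 2 * lam ^+ 2 + 72 * B * L ^+ 2 * Lx * N ^+ 2
    + 12 * Lx ^+ 2 * N + 9 * Lx ^+ 2 * N * lam ^+ 2 + 18 * Lx * N
    + 15 * N * lam ^+ 2 + 24 * N + 2).

Definition Gl (l : nat) : R :=
  let L := c_L P l in let Lx := c_Lx P l in let Ly := c_Ly P l in
  N / 2 * (
    (1 + lam ^+ 2) * (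
      72 * B ^+ 3 * c ^+ 4 * L ^+ 2 * Lx * Ly * N * m
      + 72 * B * c ^+ 2 * L ^+ 2 * Lx * Ly * N
      + 36 * B ^+ 3 * c ^+ 6 * L ^+ 2 * Ly ^+ 2 * N * m
      + 36 * B ^+ 3 * c ^+ 2 * L ^+ 2 * Lx ^+ 2 * N * m
      + 36 * B * c ^+ 4 * L ^+ 2 * Ly ^+ 2 * N
      + 36 * B * L ^+ 2 * Lx ^+ 2 * N)
    + 3 * B ^+ 2 * c ^+ 6 * L ^+ 2 * Ly ^+ 2 * N * m
    + c ^+ 4 * (
      72 * B ^+ 3 * L ^+ 2 * Ly * N * m
      + 6 * B ^+ 2 * L ^+ 2 * Lx * Ly * N * m
      + 6 * B ^+ 2 * L ^+ 2 * Ly * N * m + 3 * B ^+ 2 * Ly ^+ 2 * m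
      + 3 * L ^+ 2 * Ly ^+ 2 * N)
    + c ^+ 2 * (
      96 * B ^+ 3 * L ^+ 2 * N * m + 72 * B ^+ 3 * L ^+ 2 * Lx * N * m
      + 72 * B * L ^+ 2 * Ly * N + 60 * B ^+ 3 * L ^+ 2 * N * lam ^+ 2 * m
      + 8 * B ^+ 2 * L ^+ 2 * N * m + 6 * B ^+ 2 * L ^+ 2 * Lx * N * m
      + 6 * L ^+ 2 * Lx * Ly * N + 6 * L ^+ 2 * Ly * N
      + 3 * B ^+ 2 * L ^+ 2 * Lx ^+ 2 * N * m + B * Ly * N)
    + 96 * B * L ^+ 2 * N + 72 * B * L ^+ 2 * Lx * N
    + 60 * B * L ^+ 2 * N * lam ^+ 2 + 8 * L ^+ 2 * N + 6 * L ^+ 2 * Lx * N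
    + 3 * Lx ^+ 2 + 3 * L ^+ 2 * Lx ^+ 2 * N + B * Lx).

Definition cl (l : nat) : R := Dl l / (2 * Fl l + 2 * Dl l).

Definition rho (l : nat) : R := 1 - c_gamma P l * cl l.

Fixpoint al (l : nat) : R :=
  match l with
  | 0 =>
      Num.max (c_LJ P 0 * (1 + c) * diam)
        (8 * El 0 * (Gl 0 / Fl 0 + El 0 / Dl 0) * Fl 0 / Dl 0
          * B * diam ^+ 2)
  | l'.+1 =>
      al l' * rho l' ^+ (c_r P l' - 1)%N + 2 * c_Delta P * c_Lt P
      + c_LJ P l * c_sigma P l * (1 + c)
      + (c_Mx P l + c_My P l * c) * B * diam
      + 8 * El l * (Gl l / Fl l + El l / Dl l) * Fl l * B ^+ 2 * diam ^+ 2
          * (c_Lx P l + c_Ly P l * c ^+ 2) / (2 * Dl l)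
  end.

Definition bl (l : nat) : R :=
  if l is 0 then Dl 0 / (8 * El 0 * (Gl 0 / Fl 0 + El 0 / Dl 0) * Fl 0) * al 0
  else B * diam ^+ 2.

Definition dl (l : nat) : R := B ^+ 2 * m * c ^+ 2 * bl l.

Definition gamma_max (l : nat) : R :=
  let Lx := c_Lx P l in let Ly := c_Ly P l in
  let S := al l / bl l + 2 * El l + Dl l * cl l in
  Num.min (2 / ((3 * N + 1) * B * Lx + (3 * N ^+ 2 + 1) * B * c ^+ 2 * Ly))
  (Num.min (2 / ((1 + B) * Lx + (1 + B * N) * c ^+ 2 * Ly))
  (Num.min (Dl l / El l)
  (Num.min (Gl l / Fl l + El l / Dl l)^-1
  (Num.min (1 / (2 * cl l))
  (Num.min (Dl l / (8 * Fl l * (Gl l / Fl l + El l / Dl l) * cl l))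
  (Num.min
    ((S - Num.sqrt (S ^+ 2 - 4 * Dl l * El l * cl l)) / (2 * El l * cl l))
    (1 / 2))))))).

End Constants.

(* Main.v *)
Require Import Defs.
From HB Require Import structures.
From mathcomp Require Import all_boot all_order all_algebra.
From mathcomp Require Import all_classical all_reals all_analysis.
From mathcomp Require Import zify ring lra.
Import Order.TTheory GRing.Theory Num.Theory.
Import numFieldNormedType.Exports.
Local Open Scope classical_set_scope.
Local Open Scope ring_scope.

Set Implicit Arguments.
Unset Strict Implicit.
Unset Printing Implicit Defensive.

(** Work with the steps [s k = x (k + 1) - x k] of the true state and cut time into
    windows of B ticks. For one objective, write [alpha] for the gap at the end of
    a window, [beta] for the sum of the squared steps in it, primes for the next
    window, [h] for the objective as a function of the input alone, c for the norm
    of C, and [H = Lx + c^2 Ly].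

    All copies held by an agent are at most B ticks old, so its gradient differs
    from the true one by at most H times the distance travelled during the last
    B ticks ([enorm_gradient_lag]). Two inequalities follow.

    - Descent ([window_descent]): convexity of [h] at the new point and the
      variational inequality of the projection give
      [alpha' + (D / gamma - E) beta' <= alpha + E beta].
    - Error bound ([window_error_bound]): at the end of a window every block is the
      outcome of the last projected step of its agent in that window. The state is
      therefore the projection of a point close to [x - gamma grad h x], and the
      error bound gives
      [alpha' <= (lambda / gamma^2) (2 beta' + eps (beta + beta'))]
      with a very small eps.

    The definition of the amplitudes and the term of the stepsize bound that is a root
    of a quadratic imply [104 gamma E <= D] ([step_curvature_small]). In this regime
    [alpha + D / (4 gamma) beta] is contracted by [rho] in each window
    ([coupled_decay]), which gives the rate for [alpha]. The rate for [beta] is then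
    read off the descent inequality, because being below that root means exactly
    that [a + E b <= (D / gamma - E) rho b] ([contraction_margin]).

    The bound for [delta] follows from those for [beta]. A measurement changes the
    output held by an agent by the image under C of the displacement since the
    output it held; these periods are disjoint for each agent and have fewer than
    B ticks, so that [delta' <= N (B - 1) c^2 (beta + beta')] ([delta_le]).

    When the objective changes, the gap grows at most by the drift of the objective
    and of its minimizer, and the steps inherited from the previous objective enter
    only through [E beta <= E B diam^2]; the constant [a] of the new objective was
    defined to contain all of this ([alS_ge_El]). *)

(** * Euclidean geometry of column vectors *)

Section InnerProduct.
Context {R : realType}.

Definition dot n (x y : 'cV[R]_n) : R := (x^T *m y) 0 0.

Lemma dotE n (x y : 'cV[R]_n) : dot x y = \sum_i x i 0 * y i 0.
Proof. by rewrite /dot mxE; apply: eq_bigr => i _; rewrite mxE. Qed.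

Lemma dotC n (x y : 'cV[R]_n) : dot x y = dot y x.
Proof. by rewrite !dotE; apply: eq_bigr => i _; rewrite mulrC. Qed.

Lemma dotDl n (x y z : 'cV[R]_n) : dot (x + y) z = dot x z + dot y z.
Proof. by rewrite /dot linearD mulmxDl mxE. Qed.

Lemma dotDr n (x y z : 'cV[R]_n) : dot z (x + y) = dot z x + dot z y.
Proof. by rewrite /dot mulmxDr mxE. Qed.

Lemma dotNl n (x y : 'cV[R]_n) : dot (- x) y = - dot x y.
Proof. by rewrite /dot linearN mulNmx mxE. Qed.

Lemma dotNr n (x y : 'cV[R]_n) : dot x (- y) = - dot x y.
Proof. by rewrite dotC dotNl dotC. Qed.

Lemma dotBl n (x y z : 'cV[R]_n) : dot (x - y) z = dot x z - dot y z.
Proof. by rewrite dotDl dotNl. Qed.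

Lemma dotBr n (x y z : 'cV[R]_n) : dot z (x - y) = dot z x - dot z y.
Proof. by rewrite dotDr dotNr. Qed.

Lemma dotZl n a (x y : 'cV[R]_n) : dot (a *: x) y = a * dot x y.
Proof. by rewrite /dot linearZ -scalemxAl mxE. Qed.

Lemma dotZr n a (x y : 'cV[R]_n) : dot x (a *: y) = a * dot x y.
Proof. by rewrite dotC dotZl dotC. Qed.

Lemma dot_mulmx m n (A : 'M[R]_(m, n)) x y : dot (A^T *m x) y = dot x (A *m y).
Proof. by rewrite /dot trmx_mul trmxK mulmxA. Qed.

Lemma enorm_ge0 n (x : 'cV[R]_n) : 0 <= enorm x.
Proof. exact: sqrtr_ge0. Qed.

Lemma sqr_enorm n (x : 'cV[R]_n) : enorm x ^+ 2 = dot x x.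
Proof.
rewrite sqr_sqrtr ?dotE ?sumr_ge0// => i _; exact: sqr_ge0.
Qed.

Lemma enormE n (x : 'cV[R]_n) : enorm x = Num.sqrt (dot x x).
Proof. by rewrite -sqr_enorm sqrtr_sqr ger0_norm ?enorm_ge0. Qed.

Lemma dot_ge0 n (x : 'cV[R]_n) : 0 <= dot x x.
Proof. by rewrite -sqr_enorm sqr_ge0. Qed.

Lemma enorm0 n : enorm (0 : 'cV[R]_n) = 0.
Proof. by rewrite enormE /dot mulmx0 mxE sqrtr0. Qed.

Lemma enormN n (x : 'cV[R]_n) : enorm (- x) = enorm x.
Proof. by rewrite !enormE dotNl dotNr opprK. Qed.

Lemma enormBC n (x y : 'cV[R]_n) : enorm (x - y) = enorm (y - x).
Proof. by rewrite -enormN opprB. Qed.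

Lemma enormZ n a (x : 'cV[R]_n) : enorm (a *: x) = `|a| * enorm x.
Proof.
by rewrite !enormE dotZl dotZr mulrA -expr2 sqrtrM ?sqr_ge0// sqrtr_sqr.
Qed.

Lemma coord_le_enorm n (x : 'cV[R]_n) i : `|x i 0| <= enorm x.
Proof.
rewrite -(ler_pXn2r (ltn0Sn 1)) ?nnegrE ?enorm_ge0// sqr_enorm dotE.
rewrite (bigD1 i)//= real_normK ?num_real// -expr2 lerDl sumr_ge0// => j _.
by rewrite -expr2 sqr_ge0.
Qed.

Lemma enorm_eq0 n (x : 'cV[R]_n) : enorm x = 0 -> x = 0.
Proof.
move=> x0; apply/matrixP => i j; rewrite ord1 mxE; apply/eqP.
by rewrite -normr_le0 -x0 coord_le_enorm.
Qed.

Lemma sqr_enormD n (x y : 'cV[R]_n) :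
  enorm (x + y) ^+ 2 = enorm x ^+ 2 + 2 * dot x y + enorm y ^+ 2.
Proof. by rewrite !sqr_enorm !dotDl !dotDr (dotC y x); ring. Qed.

Lemma cauchy_schwarz n (x y : 'cV[R]_n) : dot x y <= enorm x * enorm y.
Proof.
have [x0|xn0] := eqVneq (enorm x) 0.
  by rewrite x0 (enorm_eq0 x0) /dot linear0 mul0mx mxE mul0r.
have [y0|yn0] := eqVneq (enorm y) 0.
  by rewrite y0 (enorm_eq0 y0) /dot mulmx0 mxE mulr0.
have x0 : 0 < enorm x by rewrite lt_def xn0 enorm_ge0.
have y0 : 0 < enorm y by rewrite lt_def yn0 enorm_ge0.
have := dot_ge0 (enorm y *: x - enorm x *: y).
rewrite !(dotBl, dotBr, dotZl, dotZr) (dotC y x) -!sqr_enorm => h.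
have {}h : 0 <= 2 * (enorm x * enorm y) * (enorm x * enorm y - dot x y) by lra.
by move: h; rewrite pmulr_rge0 ?subr_ge0// !mulr_gt0.
Qed.

Lemma enormD n (x y : 'cV[R]_n) : enorm (x + y) <= enorm x + enorm y.
Proof.
rewrite -(ler_pXn2r (ltn0Sn 1)) ?nnegrE ?addr_ge0 ?enorm_ge0//.
rewrite sqr_enormD; have := cauchy_schwarz x y; lra.
Qed.

Lemma enorm_sum n (I : Type) (s : seq I) (P : pred I) (v : I -> 'cV[R]_n) :
  enorm (\sum_(i <- s | P i) v i) <= \sum_(i <- s | P i) enorm (v i).
Proof.
elim/big_rec2: _ => [|i x y _ xy]; first by rewrite enorm0.
by apply: (le_trans (enormD _ _)); rewrite lerD2l.
Qed.

Lemma enorm_col_mx m n (x : 'cV[R]_m) (y : 'cV[R]_n) :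
  enorm (col_mx x y) <= enorm x + enorm y.
Proof.
rewrite -(ler_pXn2r (ltn0Sn 1)) ?nnegrE ?addr_ge0 ?enorm_ge0//.
rewrite sqr_enorm /dot tr_col_mx mul_row_col mxE -!/(dot _ _) -!sqr_enorm.
have := mulr_ge0 (enorm_ge0 x) (enorm_ge0 y); lra.
Qed.

Lemma sqr_sumr_le (w : nat -> R) a b :
  (\sum_(a <= k < b) w k) ^+ 2 <= (b - a)%:R * \sum_(a <= k < b) w k ^+ 2.
Proof.
elim: b => [|b ih]; first by rewrite !big_geq// expr0n mulr0.
have [ab|ba] := leqP a b; last by rewrite !big_geq// expr0n mulr0.
rewrite !big_nat_recr//= subSn// -natr1 sqrrD.
set S := \sum_(a <= k < b) _ in ih *; set Q := \sum_(a <= k < b) _ in ih *.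
set d := (b - a)%:R in ih *.
(* the cross term: 2 S w <= S^2 / d + d w^2 by Young, and S^2 / d <= Q by induction *)
suff : S * w b *+ 2 <= Q + d * w b ^+ 2 by move: ih; rewrite mulrDl mulrDr mul1r; lra.
have d0 : 0 <= d by rewrite ler0n.
have Q0 : 0 <= Q by rewrite sumr_ge0// => k _; exact: sqr_ge0.
have [d00|d1] := eqVneq d 0.
  have S0 : S = 0 by apply/eqP; rewrite -sqrf_eq0 eq_le sqr_ge0 andbT (le_trans ih)// d00 mul0r.
  by rewrite S0 mul0r mul0rn d00 mul0r addr0.
have dp : 0 < d by rewrite lt_def d1.
rewrite -(ler_pM2l dp).
have := sqr_ge0 (S - d * w b); nra.
Qed.

End InnerProduct.

Section OperatorNorm.
Context {R : realType}.

(** Only gives the finiteness of the supremum in [opnorm]. *)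
Lemma mulmx_bounded m n (A : 'M[R]_(m, n)) :
  exists2 c, 0 <= c & forall x, enorm (A *m x) <= c * enorm x.
Proof.
exists (\sum_i enorm (col i A)).
  by rewrite sumr_ge0// => i _; exact: enorm_ge0.
move=> x; have -> : A *m x = \sum_i x i 0 *: col i A.
  apply/matrixP => i j; rewrite mxE summxE; apply: eq_bigr => k _.
  by rewrite !mxE ord1 mulrC.
apply: (le_trans (enorm_sum _ _ _)); rewrite mulr_suml ler_sum// => i _.
by rewrite enormZ mulrC ler_wpM2l ?enorm_ge0// coord_le_enorm.
Qed.

Lemma opnorm_has_sup m n (A : 'M[R]_(m, n)) :
  has_sup [set enorm (A *m x) | x in [set x : 'cV[R]_n | enorm x <= 1]].
Proof.
split; first by exists (enorm (A *m 0)); exists 0; rewrite //= enorm0.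
have [c c0 cA] := mulmx_bounded A; exists c => _ [x /= x1 <-].
by apply: (le_trans (cA x)); rewrite ler_piMr.
Qed.

Lemma opnorm_ge0 m n (A : 'M[R]_(m, n)) : 0 <= opnorm A.
Proof.
apply: (le_trans (enorm_ge0 (A *m 0))); apply: sup_upper_bound.
  exact: opnorm_has_sup.
by exists 0; rewrite //= enorm0.
Qed.

Lemma enorm_mulmx m n (A : 'M[R]_(m, n)) x : enorm (A *m x) <= opnorm A * enorm x.
Proof.
have [x0|xn0] := eqVneq (enorm x) 0.
  by rewrite x0 (enorm_eq0 x0) mulmx0 enorm0 mulr0.
have x0 : 0 < enorm x by rewrite lt_def xn0 enorm_ge0.
rewrite -ler_pdivrMr// mulrC.
have -> : (enorm x)^-1 * enorm (A *m x) = enorm (A *m ((enorm x)^-1 *: x)).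
  by rewrite -scalemxAr enormZ ger0_norm// invr_ge0 ltW.
apply: sup_upper_bound; first exact: opnorm_has_sup.
by exists ((enorm x)^-1 *: x); rewrite //= enormZ ger0_norm ?invr_ge0 ?enorm_ge0// mulVf.
Qed.

(** [|A^T y|^2 = <y, A A^T y> <= |y| (|A| |A^T y|)], then divide by [|A^T y|]. *)
Lemma enorm_trmulmx m n (A : 'M[R]_(m, n)) y :
  enorm (A^T *m y) <= opnorm A * enorm y.
Proof.
have [z0|zn0] := eqVneq (enorm (A^T *m y)) 0.
  by rewrite z0 mulr_ge0 ?opnorm_ge0 ?enorm_ge0.
have z0 : 0 < enorm (A^T *m y) by rewrite lt_def zn0 enorm_ge0.
rewrite -(ler_pM2r z0) -expr2 sqr_enorm dot_mulmx.
apply: (le_trans (cauchy_schwarz _ _)).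
by rewrite [opnorm A * _]mulrC -mulrA ler_wpM2l ?enorm_ge0// enorm_mulmx.
Qed.

End OperatorNorm.

Section Blocks.
Context {R : realType} {N : nat} {n_ : 'I_N -> nat}.
Local Notation n := (\sum_i n_ i)%N.

Lemma dot_mxcol (u v : forall i, 'cV[R]_(n_ i)) :
  dot (\mxcol_i u i) (\mxcol_i v i) = \sum_i dot (u i) (v i).
Proof. by rewrite /dot tr_mxcol mul_mxrow_mxcol summxE. Qed.

Lemma dot_submxcol (x y : 'cV[R]_n) :
  dot x y = \sum_i dot (submxcol x i) (submxcol y i).
Proof. by rewrite -dot_mxcol !submxcolK. Qed.

Lemma sqr_enorm_mxcol (u : forall i, 'cV[R]_(n_ i)) :
  enorm (\mxcol_i u i) ^+ 2 = \sum_i enorm (u i) ^+ 2.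
Proof. by rewrite sqr_enorm dot_mxcol; apply: eq_bigr => i _; rewrite sqr_enorm. Qed.

Lemma enorm_submxcol (x : 'cV[R]_n) i : enorm (submxcol x i) <= enorm x.
Proof.
rewrite -(ler_pXn2r (ltn0Sn 1)) ?nnegrE ?enorm_ge0//.
rewrite -{2}(submxcolK x) sqr_enorm_mxcol (bigD1 i)//= lerDl sumr_ge0// => j _.
exact: sqr_ge0.
Qed.

(** Each block of [v] accumulates the increments [w k] from its own starting time.
    As [v] is the sum of the [w k] with some blocks set to zero, which does not
    increase a Euclidean norm, the bound has no factor counting the blocks. *)
Lemma enorm_delayed_sum (v : 'cV[R]_n) (w : nat -> 'cV[R]_n) a (a_ : 'I_N -> nat) b :
  (forall i, a <= a_ i)%N ->
  (forall i, submxcol v i = \sum_(a_ i <= k < b) submxcol (w k) i) ->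
  enorm v <= \sum_(a <= k < b) enorm (w k).
Proof.
move=> aa vE.
pose w' k := \mxcol_i (if (a_ i <= k)%N then submxcol (w k) i else 0).
have -> : v = \sum_(a <= k < b) w' k.
  apply/mxcolP => i; rewrite vE.
  transitivity (\sum_(a <= k < b) submxcol (w' k) i); last first.
    apply/matrixP => j k; rewrite !mxE !summxE.
    by apply: eq_bigr => l _; rewrite !mxE.
  rewrite (big_nat_widenl _ _ _ _ _ (aa i)) big_mkcond/=.
  by apply: eq_bigr => k _; rewrite mxcolK.
apply: (le_trans (enorm_sum _ _ _)); apply: ler_sum => k _.
rewrite -(ler_pXn2r (ltn0Sn 1)) ?nnegrE ?enorm_ge0//.
rewrite sqr_enorm_mxcol -{2}(submxcolK (w k)) sqr_enorm_mxcol.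
by apply: ler_sum => i _; case: ifP => // _; rewrite enorm0 expr0n sqr_ge0.
Qed.

End Blocks.

(** * Projections onto compact convex sets *)

Section Continuity.
Context {R : realType}.

Lemma sumr_continuous (T : topologicalType) n (F : 'I_n -> T -> R) :
  (forall i, continuous (F i)) -> continuous (fun x => \sum_i F i x).
Proof.
move=> cF; apply: (@continuous_big R _ +%R 0 xpredT) => //.
exact: add_continuous.
Qed.

Lemma mulmx_coord_continuous m n (A : 'M[R]_(m, n)) i :
  continuous (fun x : 'cV[R]_n => (A *m x) i 0).
Proof.
have -> : (fun x : 'cV[R]_n => (A *m x) i 0) = (fun x => \sum_k A i k * x k 0).
  by apply/funext => x; rewrite mxE.
apply: sumr_continuous => k x; apply: (@continuousM _ _ (cst (A i k))) => //.
  exact: cst_continuous.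
exact: coord_continuous.
Qed.

Lemma mx_continuous (T : topologicalType) m n (F : T -> 'M[R]_(m, n)) :
  (forall i j, continuous (fun x => F x i j)) -> continuous F.
Proof.
move=> cF x; apply/cvg_ballP => e e0.
suff : \forall z \near x, forall i j, ball (F x i j) e (F z i j).
  by apply: filterS => z Fz; split.
apply: filter_forall => i; apply: filter_forall => j.
by have /cvg_ballP := cF i j x; apply.
Qed.

Lemma mulmx_continuous m n (A : 'M[R]_(m, n)) :
  continuous (fun x : 'cV[R]_n => A *m x).
Proof. by apply: mx_continuous => i j; rewrite ord1; exact: mulmx_coord_continuous. Qed.

Lemma enormB_continuous n (x : 'cV[R]_n) : continuous (fun z : 'cV[R]_n => enorm (x - z)).
Proof.
move=> z; apply: (@continuous_comp _ _ _ _ Num.sqrt); last exact: sqrt_continuous.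
move: z; apply: sumr_continuous => k z.
apply: (@continuous_comp _ _ _ (fun z : 'cV[R]_n => (x - z) k 0) (fun u => u ^+ 2)).
  rewrite (_ : (fun z => _) = (fun z : 'cV[R]_n => x k 0 - z k 0)); last first.
    by apply/funext => y; rewrite !mxE.
  apply: (@continuousB _ _ _ (cst (x k 0)) (fun z : 'cV[R]_n => z k 0)).
    exact: cst_continuous.
  exact: coord_continuous.
exact: exprn_continuous.
Qed.

End Continuity.

Section Projection.
Context {R : realType}.

Definition convex_subset n (A : set 'cV[R]_n) :=
  forall x y t, A x -> A y -> 0 <= t <= 1 -> A (x + t *: (y - x)).

Lemma argmin_compact n (F : 'cV[R]_n -> R) A :
  A !=set0 -> compact A -> continuous F -> argmin_set F A (argmin F A).
Proof.
move=> A0 cA cF; apply: getPex.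
have [|x xA Fx] := compact_EVT_min A0 cA (f := F).
  exact: continuous_subspaceT.
by exists x; split=> [|y Ay]; [exact: set_mem|apply: Fx; exact: mem_set].
Qed.

Lemma compact_enorm_bounded n (A : set 'cV[R]_n) :
  compact A -> exists r, forall x, A x -> enorm x <= r.
Proof.
move=> cA; have [A0|/set0P/negP/negPn/eqP A0] := pselect (A !=set0); last first.
  by exists 0 => x; rewrite A0.
have [|x _ xmax] := compact_EVT_max A0 cA (f := fun z : 'cV[R]_n => enorm (0 - z)).
  by apply: continuous_subspaceT; exact: enormB_continuous.
by exists (enorm (0 - x)) => y /mem_set/xmax; rewrite !sub0r !enormN.
Qed.

Lemma le_ediam n (A : set 'cV[R]_n) x y :
  compact A -> A x -> A y -> enorm (x - y) <= ediam A.
Proof.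
move=> /compact_enorm_bounded[r Ar] Ax Ay; apply: sup_upper_bound; last by exists (x, y).
split; first by exists (enorm (x - y)), (x, y).
exists (r + r) => _ [[u v] [/= Au Av] <-].
by rewrite (le_trans (enormD _ _))// enormN lerD// Ar.
Qed.

Section CompactConvex.
Variables (n : nat) (A : set 'cV[R]_n).
Hypotheses (A0 : A !=set0) (cA : compact A).

Lemma euclid_proj_in (x : 'cV[R]_n) : A (euclid_proj A x).
Proof. exact: (argmin_compact A0 cA (enormB_continuous (x := x))).1. Qed.

(** Moving from the projection towards a point of the set cannot decrease the
    distance, to first order. *)
Lemma euclid_proj_dot_le0 (x w : 'cV[R]_n) : convex_subset A -> A w ->
  dot (x - euclid_proj A x) (w - euclid_proj A x) <= 0.
Proof.
move=> convA Aw; set p := euclid_proj A x.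
have [Ap pmin] := argmin_compact A0 cA (enormB_continuous (x := x)).
rewrite leNgt; apply/negP; set d := dot _ _ => d0.
set q := dot (w - p) (w - p); have q0 : 0 <= q by exact: dot_ge0.
have dq0 : 0 < d + q by rewrite ltr_wpDr.
(* any step t in ]0, 1] with t q <= d would contradict minimality *)
pose t := d / (d + q).
have t0 : 0 < t by rewrite divr_gt0.
have t1 : t <= 1 by rewrite ler_pdivrMr// mul1r lerDl.
have /pmin : A (p + t *: (w - p)) by apply: convA => //; rewrite (ltW t0).
rewrite -(ler_pXn2r (ltn0Sn 1)) ?nnegrE ?enorm_ge0// -/(euclid_proj A x) -/p.
rewrite (_ : x - (p + _) = (x - p) + (- t) *: (w - p)); last by rewrite scaleNr opprD addrA.
rewrite [enorm (x - p + _) ^+ 2]sqr_enormD dotZr enormZ exprMn normrN.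
rewrite real_normK ?num_real// (sqr_enorm (w - p)) -/d -/q => h.
have tq : t * q <= d by rewrite /t mulrAC ler_pdivrMr// ler_wpM2l ?(ltW d0)// lerDr ltW.
(* the squared distance changed by t^2 q - 2 t d <= - t d < 0 *)
have td : 0 < t * d by rewrite mulr_gt0.
have ttq : t * (t * q) <= t * d by rewrite ler_pM2l.
lra.
Qed.

End CompactConvex.

(** Nonexpansiveness of projections, in terms of the variational inequalities that
    characterize [u] and [v] as the projections of [z] and [z'], so that it applies to
    a point known to be a projection block by block only. *)
Lemma le_enorm_of_dot_le0 n (z z' u v : 'cV[R]_n) :
  dot (z - u) (v - u) <= 0 -> dot (z' - v) (u - v) <= 0 ->
  enorm (u - v) <= enorm (z - z').
Proof.
move=> zu zv; have [uv0|uvn0] := eqVneq (enorm (u - v)) 0.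
  by rewrite uv0 enorm_ge0.
have uv0 : 0 < enorm (u - v) by rewrite lt_def uvn0 enorm_ge0.
rewrite -(ler_pM2r uv0); apply: le_trans (cauchy_schwarz _ _).
rewrite -expr2 sqr_enorm; move: zu zv; rewrite !dotBl !dotBr; lra.
Qed.

End Projection.

Section ProductSet.
Context {R : realType} {N : nat} {n_ : 'I_N -> nat}.
Variable X_ : forall i : 'I_N, set 'cV[R]_(n_ i).
Arguments X_ : clear implicits.

Lemma polyhedral_convex n (A : set 'cV[R]_n) : polyhedral A -> convex_subset A.
Proof.
move=> [q [M [b ->]]] x y t /= Mx My t01 i.
rewrite mulmxDr -scalemxAr mulmxBr !mxE.
move: (Mx i) (My i); rewrite !mxE; set u := \sum_j _; set v := \sum_j _; nra.
Qed.

Lemma prod_set_convex : (forall i : 'I_N, convex_subset (X_ i)) -> convex_subset (prod_set X_).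
Proof.
move=> convX x y t Xx Xy t01 i.
have -> : submxcol (x + t *: (y - x)) i = submxcol x i + t *: (submxcol y i - submxcol x i).
  by apply/matrixP => j k; rewrite !mxE.
exact: convX.
Qed.

Lemma prod_set_nonempty : (forall i : 'I_N, X_ i !=set0) -> prod_set X_ !=set0.
Proof.
move=> X0; exists (\mxcol_i sval (cid (X0 i))) => i /=.
by rewrite mxcolK; case: cid.
Qed.

(** Closed, because each factor is, and contained in a box: a bound on the norms in
    a factor bounds the coordinates of the corresponding block. *)
Lemma prod_set_compact : (forall i : 'I_N, compact (X_ i)) -> compact (prod_set X_).
Proof.
move=> cX.
have sub_cont i : continuous (fun x : 'cV[R]_(\sum_i n_ i) => submxcol x i).
  apply: mx_continuous => j k.
  rewrite (_ : (fun x => _) = (fun x : 'cV[R]_(\sum_i n_ i) => x (tagnat.Rank i j) k)); last first.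
    by apply/funext => x; rewrite mxE.
  exact: coord_continuous.
have clX : closed (prod_set X_).
  have -> : prod_set X_ = \bigcap_(i in setT) (fun x => submxcol x i) @^-1` X_ i.
    by apply/seteqP; split=> [x Xx i _|x Xx i]; exact: Xx.
  apply: closed_bigI => i _; apply: closed_comp; first by move=> x _; exact: sub_cont.
  by apply: compact_closed => //; exact: norm_hausdorff.
pose r i := sval (cid (compact_enorm_bounded (cX i))).
have rX i x : X_ i x -> enorm x <= r i by rewrite /r; case: cid => /= s; exact.
pose box : set 'rV[R]_(\sum_i n_ i) :=
  [set v | forall j, `[- r (tagnat.sig1 j), r (tagnat.sig1 j)]%classic (v ord0 j)].
have cbox : compact box.
  apply: (@rV_compact R _ (fun j => `[- r (tagnat.sig1 j), r (tagnat.sig1 j)]%classic)) => j.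
  exact: segment_compact.
apply: (@subclosed_compact _ _ [set v^T | v in box] clX).
  apply: continuous_compact => //; apply: continuous_subspaceT.
  apply: mx_continuous => i j.
  rewrite (_ : (fun x => _) = (fun x : 'rV[R]_(\sum_i n_ i) => x j i)); last first.
    by apply/funext => x; rewrite mxE.
  exact: coord_continuous.
move=> x Xx; exists x^T; last by rewrite trmxK.
move=> j /=; rewrite in_itv/= -ler_norml mxE.
have := coord_le_enorm (submxcol x (tagnat.sig1 j)) (tagnat.sig2 j).
by rewrite mxE tagnat.sig2K => /le_trans; apply; exact: rX.
Qed.

End ProductSet.

(** * First-order convexity *)

Section Gradient.
Context {R : realType}.

Lemma differentiable_grad n (h : 'cV[R]_n -> R) x v :
  differentiable h x -> 'D_v h x = dot (grad h x) v.
Proof.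
move=> dh; rewrite deriveE// dotE.
have {1}-> : v = \sum_i v i 0 *: delta_mx i 0.
  apply/matrixP => i j; rewrite ord1 summxE (bigD1 i)//= !mxE !eqxx mulr1.
  by rewrite big1 ?addr0// => k ki; rewrite !mxE eq_sym (negPf ki) mulr0.
rewrite linear_sum; apply: eq_bigr => i _.
by rewrite linearZ mulrC mxE deriveE.
Qed.

(** The difference quotients of [h] at [x] towards [z] are at most [h z - h x] by
    convexity, hence so is the directional derivative. *)
Lemma convex_gradient_le n p (h : 'cV[R]_n -> R) x z :
  0 <= p -> strongly_convex p h -> differentiable h x ->
  h x - h z <= dot (grad h x) (x - z).
Proof.
move=> p0 hp dh.
suff : dot (grad h x) (z - x) <= h z - h x.
  by rewrite -opprB dotNr; lra.
rewrite -differentiable_grad//.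
have dhv : derivable h x (z - x) by exact: diff_derivable.
rewrite /derive cvg_at_rightE//; apply: limr_le.
  move/cvg_ex: dhv => [l fl]; apply/cvg_ex; exists l; apply: cvg_trans fl; apply: cvg_app.
  move=> A [e e0 eA]; exists e => //= y ye y0; apply: eA => //.
  exact: lt0r_neq0.
near=> t.
have t0 : 0 < t by near: t; exact: nbhs_right_gt.
have t1 : t <= 1 by near: t; apply: nbhs_right_le.
rewrite /= [_ *: _]mulrC ler_pdivrMr// lerBlDr.
have -> : t *: (z - x) + x = t *: z + (1 - t) *: x.
  by rewrite scalerBr scalerBl scale1r addrAC -addrA.
apply: (le_trans (hp z x t _)); first by rewrite (ltW t0).
have : 0 <= p / 2 * t * (1 - t) * enorm (z - x) ^+ 2.
  apply: mulr_ge0 (sqr_ge0 _); apply: mulr_ge0; last by rewrite subr_ge0.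
  by rewrite mulr_ge0 ?divr_ge0// ltW.
lra.
Unshelve. all: by end_near.
Qed.

End Gradient.

(** * The rate of the coupled recursions *)

Section Rate.
Context {R : realType}.

(** The potential is [al k + u / 4 * be k] with [u = D / gam]. The weight must exceed
    [E], so that the term [E * be k] of the first recursion is absorbed with a
    margin, and be less than [u - E], so that [be k.+1] is too; as [E] is at most
    [u / 104], there is much room. The second recursion then bounds the potential
    by what it loses in one step: its coefficient is of order [lam / gam ^ 2],
    so the relative loss is of order [gam * D / lam], and [F] exceeds [lam]. *)
Lemma coupled_decay (al be : nat -> R) (n : nat) (gam D E F lam eps : R) :
  let c := D / (2 * F + 2 * D) in let rh := 1 - gam * c in
  0 < gam <= 2^-1 -> 0 < D <= 1 -> 0 <= E -> 104 * (gam * E) <= D ->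
  0 <= lam -> 15 / 2 * lam ^+ 2 + 13 <= F -> 0 <= eps <= 100^-1 ->
  (forall k, 0 <= al k) -> (forall k, 0 <= be k) ->
  (forall k, (k < n)%N ->
     al k.+1 + (D / gam - E) * be k.+1 <= al k + E * be k) ->
  (forall k, (k < n)%N ->
     al k.+1 <= lam / gam ^+ 2 * (2 * be k.+1 + eps * (be k.+1 + be k))) ->
  forall k, (k < n)%N -> al k.+1 + D / gam / 4 * be k.+1 <= (al 0%N + E * be 0%N) * rh ^+ k.
Proof.
move=> c rh /andP[g0 g2] /andP[D0 D1] E0 gE l0 lF /andP[e0 e1] al0 be0 desc eb.
pose u := D / gam; have u0 : 0 < u by rewrite divr_gt0.
have Eu : 104 * E <= u by rewrite /u ler_pdivlMr//; lra.
have F13 : 13 <= F by have := sqr_ge0 lam; lra.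
have lamF : 10 * lam <= F by have := sqr_ge0 (lam - 2 / 3); lra.
have FD0 : 0 < F + D by lra.
pose th := gam * D / (F + D).
have cE : c = D / (F + D) / 2.
  by rewrite /c -mulrDr invfM mulrCA mulrC.
have c0 : 0 < c by rewrite cE divr_gt0// divr_gt0.
have thE : th = 2 * (gam * c) by rewrite /th cE; field; rewrite lt0r_neq0.
have th0 : 0 < th by rewrite thE mulr_gt0// mulr_gt0.
have th26 : th <= 26^-1.
  rewrite /th ler_pdivrMr//; have : gam * D <= 2^-1 * 1 by rewrite ler_pM// ltW.
  lra.
have rh0 : 0 <= rh by rewrite /rh; lra.
(* contraction by 1 / (1 + th) is at least as good as contraction by rh *)
have thrh : 1 <= (1 + th) * rh.
  rewrite /rh; have -> : gam * c = th / 2 by rewrite thE; field.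
  have : th * th <= th * 1 by rewrite ler_pM2l//; lra.
  lra.
have thlam : th * (lam / gam ^+ 2) <= u / 10.
  have -> : th * (lam / gam ^+ 2) = u * (lam / (F + D)).
    by rewrite /th /u; field; rewrite !lt0r_neq0.
  by rewrite ler_pM2l// ler_pdivrMr//; lra.
elim=> [|k ih] kn.
  rewrite expr0 mulr1; apply: le_trans (desc 0%N kn); rewrite lerD2l.
  by rewrite -/u ler_wpM2r//; lra.
have {ih} := ih (ltnW kn); rewrite -/u exprSr mulrA; set W := al k.+1 + _ => ih.
set W' := al k.+2 + _.
have W'0 : 0 <= W' by rewrite addr_ge0// mulr_ge0// divr_ge0// ltW.
suff WW : (1 + th) * W' <= W.
  apply: (@le_trans _ _ (W * rh)); last by rewrite ler_wpM2r.
  apply: (@le_trans _ _ (((1 + th) * rh) * W')); first by rewrite ler_peMl.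
  by rewrite mulrAC ler_wpM2r.
have h1 := desc _ kn; have h2 := eb _ kn.
have {}h2 : th * al k.+2 <= u / 10 * (2 * be k.+2 + 100^-1 * (be k.+2 + be k.+1)).
  apply: (le_trans (ler_wpM2l (ltW th0) h2)); rewrite mulrA ler_pM//.
  - by rewrite mulr_ge0 ?(ltW th0)// divr_ge0// exprn_ge0// ltW.
  - by rewrite addr_ge0 ?mulr_ge0 ?addr_ge0.
  - by rewrite lerD2l ler_wpM2r ?addr_ge0.
have h3 : th * (u / 4 * be k.+2) <= 26^-1 * (u / 4 * be k.+2).
  by rewrite ler_wpM2r// mulr_ge0// divr_ge0// ltW.
have h4 : E * be k.+1 <= u / 104 * be k.+1 by rewrite ler_wpM2r//; lra.
have h5 : E * be k.+2 <= u / 104 * be k.+2 by rewrite ler_wpM2r//; lra.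
have h6 : 0 <= u * be k.+1 by rewrite mulr_ge0// ltW.
have h7 : 0 <= u * be k.+2 by rewrite mulr_ge0// ltW.
rewrite -/u in h1; rewrite /W /W'; lra.
Qed.

(** Without any error bound: the first recursion alone carries the rate from [al]
    over to [be], provided the amplitudes [a] and [b] are compatible. *)
Lemma coupled_decay_snd (al be : nat -> R) (n : nat) (u E a b rh : R) :
  0 <= rh -> 0 <= E -> E < u -> a + E * b <= (u - E) * rh * b ->
  (forall k, 0 <= al k) ->
  (forall k, (k < n)%N -> al k.+1 + (u - E) * be k.+1 <= al k + E * be k) ->
  (forall k, (k < n)%N -> al k.+1 <= a * rh ^+ k) ->
  be 1%N <= b ->
  forall k, (k < n)%N -> be k.+1 <= b * rh ^+ k.
Proof.
move=> rh0 E0 Eu abE al0 desc ala be1; elim=> [|k ih] kn; first by rewrite mulr1.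
have {}ih := ih (ltnW kn).
rewrite -(@ler_pM2l _ (u - E)) ?subr_gt0//.
have h1 := desc _ kn; have h2 := ala _ (ltnW kn).
have h3 : E * be k.+1 <= E * (b * rh ^+ k) by rewrite ler_wpM2l.
have h4 : (a + E * b) * rh ^+ k <= (u - E) * rh * b * rh ^+ k.
  by rewrite ler_wpM2r// exprn_ge0.
by rewrite exprS; have := al0 k.+2; lra.
Qed.

End Rate.

(** * The constants of the theorem *)

Section ConstantBounds.
Context {R : realType}.
Variable P : constants R.
Local Notation N := ((c_N P)%:R : R).
Local Notation B := ((c_B P)%:R : R).
Local Notation c := (c_C P).
Local Notation diam := (c_diam P).
Local Notation gam := (c_gamma P).
Local Notation Q l := (8 * El P l * (Gl P l / Fl P l + El P l / Dl P l) * Fl P l / Dl P l).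

Hypotheses (N1 : (0 < c_N P)%N) (B1 : (0 < c_B P)%N) (C0 : 0 <= c) (diam0 : 0 <= diam).
Hypothesis lam0 : 0 <= c_lam P.

Let N_ge1 : 1 <= N. Proof. by rewrite ler1n. Qed.
Let B_ge1 : 1 <= B. Proof. by rewrite ler1n. Qed.

Ltac pos := repeat lazymatch goal with
  | |- is_true (0 <= _ + _) => apply: addr_ge0
  | |- is_true (0 <= _ * _) => apply: mulr_ge0
  | |- is_true (0 <= _ ^+ _) => apply: exprn_ge0
  | |- is_true (0 <= _ ^-1) => rewrite invr_ge0
  | |- _ => by []
  end.

Section OneObjective.
Variable l : nat.
Hypotheses (Lx0 : 0 < c_Lx P l) (Ly0 : 0 < c_Ly P l) (L0 : 0 < c_L P l).
Hypothesis step_bound : 2 / (B * (c_Lx P l + c_Ly P l * c ^+ 2)) <= 1.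
Hypotheses (gam0 : 0 < gam l) (gam_max : gam l < gamma_max P l).

Let Lx_ge0 := ltW Lx0.
Let Ly_ge0 := ltW Ly0.
Let L_ge0 := ltW L0.

Lemma Fl_ge : 15 / 2 * c_lam P ^+ 2 + 13 <= Fl P l.
Proof.
rewrite /Fl /=; set rest := (X in _ <= 2^-1 * (X + 15 * N * c_lam P ^+ 2 + 24 * N + 2)).
have rest0 : 0 <= rest by rewrite /rest; pos.
have : 1 * c_lam P ^+ 2 <= N * c_lam P ^+ 2 by rewrite ler_wpM2r// sqr_ge0.
clearbody rest; have := N_ge1; lra.
Qed.

Lemma Gl_ge0 : 0 <= Gl P l.
Proof. by rewrite /Gl /=; pos. Qed.

Lemma two_le_B_curvature : 2 <= B * (c_Lx P l + c_Ly P l * c ^+ 2).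
Proof.
have H0 : 0 < c_Lx P l + c_Ly P l * c ^+ 2.
  by rewrite ltr_pwDl// mulr_ge0// sqr_ge0.
have BH : 0 < B * (c_Lx P l + c_Ly P l * c ^+ 2) by rewrite mulr_gt0// ltr0n.
by move: step_bound; rewrite ler_pdivrMr// mul1r.
Qed.

Lemma El_ge : N * B * (c_Lx P l + c ^+ 2 * c_Ly P l) <= 2 * El P l.
Proof.
have -> : 2 * El P l = N * B * (c_Lx P l + c_Ly P l * N * c ^+ 2) by rewrite /El; field.
have h : 0 <= c ^+ 2 * c_Ly P l by rewrite mulr_ge0// sqr_ge0.
rewrite ler_wpM2l ?mulr_ge0// lerD2l (_ : c_Ly P l * N * _ = c ^+ 2 * c_Ly P l * N); last by ring.
exact: ler_peMr.
Qed.

Lemma El_ge1 : 1 <= El P l.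
Proof.
have h1 := El_ge; have h2 := two_le_B_curvature.
have : 1 * (B * (c_Lx P l + c_Ly P l * c ^+ 2)) <= N * (B * (c_Lx P l + c_Ly P l * c ^+ 2)).
  by rewrite ler_wpM2r//; lra.
rewrite mulrA; move: h1; rewrite [c ^+ 2 * _]mulrC; lra.
Qed.

Lemma gam_lt_half : gam l < 2^-1.
Proof.
move: gam_max; rewrite /gamma_max !lt_min => /andP[_ /and5P[_ _ _ _ /and3P[_ _]]].
by rewrite div1r.
Qed.

Lemma Dl_gt0 : 0 < Dl P l.
Proof.
move: gam_max; rewrite /gamma_max !lt_min => /andP[_ /andP[h _]].
move: h; set S := (X in _ < 2 / X).
rewrite ltr_pdivlMr; first by rewrite /Dl -/S; lra.
by apply: ltr_pwDl; [rewrite mulr_gt0//; lra|pos].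
Qed.

Lemma Dl_lt1 : Dl P l < 1.
Proof.
rewrite /Dl; set S := (X in 2 - _ * X).
have S0 : 0 < S by apply: ltr_pwDl; [rewrite mulr_gt0//; lra|pos].
by have := mulr_gt0 gam0 S0; lra.
Qed.

Lemma rho_bounds : 3 / 4 <= rho P l < 1.
Proof.
have D0 := Dl_gt0; have F13 := Fl_ge; have := sqr_ge0 (c_lam P) => s0.
have c0 : 0 < cl P l by rewrite /cl divr_gt0//; lra.
have c2 : cl P l <= 2^-1 by rewrite /cl ler_pdivrMr; lra.
have gc0 := mulr_gt0 gam0 c0.
have : gam l * cl P l <= 2^-1 * 2^-1.
  by rewrite ler_pM ?(ltW gam0) ?(ltW c0) ?(ltW gam_lt_half).
rewrite /rho; lra.
Qed.

(** The right-hand side is the coefficient that the descent estimate yields; the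
    paired constants [D] and [E] leave it some room. *)
Lemma descent_coefficient (H := c_Lx P l + c ^+ 2 * c_Ly P l) :
  Dl P l / gam l - El P l <= (gam l)^-1 - 2^-1 * (B + N * B) * H.
Proof.
have -> : Dl P l / gam l =
    (gam l)^-1 - 2^-1 * ((1 + B) * c_Lx P l + (1 + B * N) * c ^+ 2 * c_Ly P l).
  by rewrite /Dl; field; rewrite lt0r_neq0.
rewrite /El /H.
have h1 : B * N * (c ^+ 2 * c_Ly P l) <= B * N * (c ^+ 2 * c_Ly P l) * N.
  by rewrite ler_peMr//; pos.
have h2 : B * (c ^+ 2 * c_Ly P l) <= B * (c ^+ 2 * c_Ly P l) * N by rewrite ler_peMr//; pos.
have h3 : 0 <= c ^+ 2 * c_Ly P l by pos.
have := Lx_ge0; lra.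
Qed.

(** Here [F / D >= 13] because [F] contains [12 N + 1], and [G / F + E / D >= 1]. *)
Lemma Q_ge : 104 * El P l <= Q l.
Proof.
have E1 := El_ge1; have D0 := Dl_gt0; have D1 := Dl_lt1.
have F13 := Fl_ge; have s0 := sqr_ge0 (c_lam P).
have F0 : 0 < Fl P l by lra.
have E0 : 0 <= El P l by lra.
rewrite (_ : _ / Dl P l =
  8 * (El P l * (Gl P l / Fl P l + El P l / Dl P l)) * (Fl P l / Dl P l)); last first.
  by rewrite !mulrA.
have e1 : 1 <= Gl P l / Fl P l + El P l / Dl P l.
  rewrite ler_wpDl//; first by rewrite divr_ge0 ?Gl_ge0// ltW.
  by rewrite ler_pdivlMr//; lra.
have e2 : 13 <= Fl P l / Dl P l.
  rewrite ler_pdivlMr//; have : 13 * Dl P l <= 13 * 1 by rewrite ler_wpM2l// ltW.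
  lra.
have e3 : El P l * 1 <= El P l * (Gl P l / Fl P l + El P l / Dl P l) by rewrite ler_wpM2l.
have : (8 * (El P l * 1)) * 13 <=
    (8 * (El P l * (Gl P l / Fl P l + El P l / Dl P l))) * (Fl P l / Dl P l).
  by rewrite ler_pM//; lra.
lra.
Qed.

(** The amplitudes satisfy [al >= Q * bl] with [Q] at least [8 E^2 F / D^2], and the
    term of [gamma_max] that is a root of a quadratic forces [al / bl < D / gam]. This is what makes
    the stepsize so small that every effect of the delays is a perturbation. *)
Hypothesis bl_gt0 : 0 < bl P l.
Hypothesis Q_le : Q l * bl P l <= al P l.

(** Below the smaller root of [E c g^2 - S g + D] that polynomial in [g] is positive,
    and at [g = gam] its value is [gam / bl] times the difference of the two sides of
    the first inequality. *)
Lemma contraction_margin :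
  al P l + El P l * bl P l <= (Dl P l / gam l - El P l) * rho P l * bl P l
  /\ al P l / bl P l < Dl P l / gam l.
Proof.
have E1 := El_ge1; have D0 := Dl_gt0; have F13 := Fl_ge.
have s0 := sqr_ge0 (c_lam P); have /andP[r1 r2] := rho_bounds.
have c0 : 0 < cl P l by rewrite /cl divr_gt0//; lra.
have E0 : 0 < El P l by lra.
move: gam_max; rewrite /gamma_max !lt_min => /andP[_ /and5P[_ _ _ _ /and3P[_ h _]]].
move: h; set ab := al P l / bl P l; set S := ab + _ + _; set W := Num.sqrt _ => h.
have Ec : 0 < 2 * El P l * cl P l by rewrite mulr_gt0// mulr_gt0.
move: h; rewrite ltr_pdivlMr// => h.
(* a negative discriminant is harmless: its square root is 0 by convention *)
have W0 : 0 <= W by exact: sqrtr_ge0.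
have WS : S ^+ 2 - 4 * Dl P l * El P l * cl P l <= W ^+ 2.
  have [s|s] := leP 0 (S ^+ 2 - 4 * Dl P l * El P l * cl P l).
    by rewrite sqr_sqrtr.
  by rewrite (le_trans (ltW s))// sqr_ge0.
have h2 : W ^+ 2 < (S - gam l * (2 * El P l * cl P l)) ^+ 2.
  by rewrite ltr_pXn2r// ?nnegrE; lra.
have {h2} quad : 0 < El P l * cl P l * gam l ^+ 2 - S * gam l + Dl P l.
  have : 0 < (4 * El P l * cl P l) * (El P l * cl P l * gam l ^+ 2 - S * gam l + Dl P l).
    by move: h2 WS; rewrite sqrrB; lra.
  by rewrite pmulr_rgt0// mulr_gt0// mulr_gt0.
have margin : ab + El P l < (Dl P l / gam l - El P l) * rho P l.
  rewrite -subr_gt0 -(pmulr_rgt0 _ gam0).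
  suff -> : gam l * ((Dl P l / gam l - El P l) * rho P l - (ab + El P l)) =
     El P l * cl P l * gam l ^+ 2 - S * gam l + Dl P l.
    by [].
  by rewrite /rho /S; field; rewrite lt0r_neq0.
split.
  have -> : al P l + El P l * bl P l = (ab + El P l) * bl P l.
    by rewrite mulrDl /ab divfK// lt0r_neq0.
  by rewrite ler_pM2r// ltW.
have Q0 : 0 <= ab.
  rewrite divr_ge0 ?(ltW bl_gt0)//; apply: le_trans Q_le.
  by rewrite mulr_ge0 ?(ltW bl_gt0)//; apply: le_trans Q_ge; lra.
have r0 : 0 < rho P l by lra.
have u0 : 0 < Dl P l / gam l - El P l by rewrite -(pmulr_lgt0 _ r0); lra.
have : (Dl P l / gam l - El P l) * rho P l <= (Dl P l / gam l - El P l) * 1.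
  by rewrite ler_pM2l// ltW.
lra.
Qed.

Lemma step_curvature_small : 104 * (gam l * El P l) <= Dl P l.
Proof.
have E1 := El_ge1; have D0 := Dl_gt0; have F13 := Fl_ge; have s0 := sqr_ge0 (c_lam P).
have D1 := Dl_lt1.
have [_ h] := contraction_margin.
have {h} : Q l < Dl P l / gam l.
  by apply: le_lt_trans h; rewrite ler_pdivlMr.
rewrite ltr_pdivlMr// => h.
have h2 := Q_ge.
have : 104 * El P l * gam l <= Q l * gam l by rewrite ler_wpM2r// ltW.
lra.
Qed.

End OneObjective.

Section Amplitudes.
Variable T : nat.
Hypotheses (Lx0 : forall l, (l <= T)%N -> 0 < c_Lx P l)
  (Ly0 : forall l, (l <= T)%N -> 0 < c_Ly P l)
  (L0 : forall l, (l <= T)%N -> 0 < c_L P l)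
  (LJ0 : forall l, (l <= T)%N -> 0 < c_LJ P l)
  (Mx0 : forall l, (l <= T)%N -> 0 < c_Mx P l)
  (My0 : forall l, (l <= T)%N -> 0 < c_My P l)
  (Lt0 : 0 < c_Lt P) (Delta0 : 0 < c_Delta P)
  (sigma0 : forall l, (l < T)%N -> 0 < c_sigma P l.+1)
  (step_bound : forall l, (l <= T)%N -> 2 / (B * (c_Lx P l + c_Ly P l * c ^+ 2)) <= 1)
  (gam_bounds : forall l, (l <= T)%N -> 0 < gam l < gamma_max P l).

Let Q_gt0 l : (l <= T)%N -> 0 < Q l.
Proof.
move=> lT; have /andP[g0 g1] := gam_bounds lT.
have E1 := El_ge1 (Lx0 lT) (Ly0 lT) (step_bound lT).
have := Q_ge (Lx0 lT) (Ly0 lT) (L0 lT) (step_bound lT) g0 g1.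
by apply: lt_le_trans; lra.
Qed.

Let rho_ge0 l : (l <= T)%N -> 0 <= rho P l.
Proof.
move=> lT; have /andP[g0 g1] := gam_bounds lT.
by have /andP[r0 _] := rho_bounds (Lx0 lT) (Ly0 lT) (L0 lT) g0 g1; lra.
Qed.

Let Bdiam_ge0 : 0 <= B * diam ^+ 2.
Proof. by rewrite mulr_ge0// sqr_ge0. Qed.

Lemma al0_ge : c_LJ P 0 * (1 + c) * diam <= al P 0.
Proof. by rewrite /= le_max lexx. Qed.

Lemma al0_ge_Q : Q 0 * (B * diam ^+ 2) <= al P 0.
Proof. by rewrite /= le_max mulrA lexx orbT. Qed.

(** The last summand of [al P l.+1] dominates [Q l.+1 * B * diam ^ 2] because
    twice it equals that product times [B * (Lx + Ly c^2)], which is at least 2. *)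
Lemma alS_ge l : (l < T)%N -> 0 <= al P l ->
  al P l * rho P l ^+ (c_r P l - 1)%N + 2 * c_Delta P * c_Lt P
    + c_LJ P l.+1 * c_sigma P l.+1 * (1 + c) + Q l.+1 * (B * diam ^+ 2) <= al P l.+1.
Proof.
move=> lT a0 /=; rewrite lerD//.
  rewrite lerDl; apply: mulr_ge0 => //; apply: mulr_ge0 => //.
  by apply: addr_ge0; [exact/ltW/Mx0|apply: mulr_ge0 => //; exact/ltW/My0].
rewrite [leRHS](_ : _ = Q l.+1 * (B * diam ^+ 2)
  * (B * (c_Lx P l.+1 + c_Ly P l.+1 * c ^+ 2) / 2)); last first.
  set A := _ + _ / _; have D0 : Dl P l.+1 != 0.
    have /andP[_ g1] := gam_bounds lT.
    by rewrite lt0r_neq0//; exact: (Dl_gt0 (Lx0 lT) (Ly0 lT) g1).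
  move: (Dl P l.+1) A D0 => D A D0; field; exact: D0.
rewrite ler_peMr//; first by apply: mulr_ge0 => //; exact/ltW/Q_gt0.
by have := two_le_B_curvature (Lx0 lT) (Ly0 lT) (step_bound lT); lra.
Qed.

Let Q_le_alS l : (l < T)%N -> 0 <= al P l -> Q l.+1 * (B * diam ^+ 2) <= al P l.+1.
Proof.
move=> lT a0; apply: le_trans (alS_ge lT a0); rewrite lerDr.
apply: addr_ge0; last first.
  by rewrite mulr_ge0 ?addr_ge0// mulr_ge0 ?(ltW (LJ0 lT)) ?(ltW (sigma0 lT)).
apply: addr_ge0; last by rewrite mulr_ge0 ?(ltW Lt0)// mulr_ge0 ?(ltW Delta0).
by apply: mulr_ge0 a0 _; apply: exprn_ge0; exact: rho_ge0 (ltnW lT).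
Qed.

Lemma al_ge0 l : (l <= T)%N -> 0 <= al P l.
Proof.
elim: l => [|l ih] lT.
  by apply: le_trans al0_ge_Q; apply: mulr_ge0 => //; exact/ltW/Q_gt0.
apply: le_trans (Q_le_alS lT (ih (ltnW lT))).
by apply: mulr_ge0 => //; exact/ltW/Q_gt0.
Qed.

Let bl0E : bl P 0 = al P 0 / Q 0.
Proof. by rewrite [RHS]mulrC invf_div. Qed.

Lemma Q_bl_le_al l : (l <= T)%N -> Q l * bl P l <= al P l.
Proof.
case: l => [|l] lT; last exact: Q_le_alS lT (al_ge0 (ltnW lT)).
by rewrite bl0E mulrC divfK// lt0r_neq0//; exact: Q_gt0.
Qed.

Lemma Bdiam_le_bl l : (l <= T)%N -> B * diam ^+ 2 <= bl P l.
Proof.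
case: l => [|l] lT; last exact: lexx.
by rewrite bl0E ler_pdivlMr ?Q_gt0// mulrC; exact: al0_ge_Q.
Qed.

Lemma alS_ge_El l : (l < T)%N ->
  al P l * rho P l ^+ (c_r P l - 1)%N + 2 * c_Delta P * c_Lt P
    + c_LJ P l.+1 * c_sigma P l.+1 * (1 + c) + El P l.+1 * (B * diam ^+ 2) <= al P l.+1.
Proof.
move=> lT; apply: le_trans (alS_ge lT (al_ge0 (ltnW lT))).
rewrite lerD2l ler_wpM2r//; have /andP[g0 g1] := gam_bounds lT.
have E1 := El_ge1 (Lx0 lT) (Ly0 lT) (step_bound lT).
have := Q_ge (Lx0 lT) (Ly0 lT) (L0 lT) (step_bound lT) g0 g1.
by apply: le_trans; lra.
Qed.

End Amplitudes.

End ConstantBounds.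

(** * Trajectories of the algorithm *)

Section Trajectory.
Context {R : realType} {N : nat} {n_ m_ : 'I_N -> nat}.
Local Notation n := (\sum_i n_ i)%N.
Local Notation m := (\sum_i m_ i)%N.
Variables (C : 'M[R]_(m, n)) (X_ : forall i : 'I_N, set 'cV[R]_(n_ i)).
Variables (f : 'cV[R]_n -> nat -> R) (g : 'cV[R]_m -> nat -> R).
Variables (T : nat) (t : nat -> nat) (B : nat) (kappa : nat -> nat) (gamma : nat -> R).
Variables (K M : 'I_N -> set nat) (Cm : 'I_N -> 'I_N -> set nat).
Variables (tau mu : 'I_N -> 'I_N -> nat -> nat).
Variables (xs : forall i j : 'I_N, nat -> 'cV[R]_(n_ j)).
Variables (ys : forall i j : 'I_N, nat -> 'cV[R]_(m_ j)).
Arguments X_ : clear implicits.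
Arguments xs : clear implicits.
Arguments ys : clear implicits.

Local Notation X := (prod_set X_).
Local Notation horizon := (start kappa T.+1).
Local Notation x := (xtrue xs).
Local Notation s := (sstep xs K).
Local Notation c := (opnorm C).

Hypothesis B_gt0 : (0 < B)%N.
Hypothesis X_ne : forall i : 'I_N, X_ i !=set0.
Hypothesis X_compact : forall i : 'I_N, compact (X_ i).
Hypothesis X_convex : forall i : 'I_N, convex_subset (X_ i).
Hypothesis PA : partial_asynchrony B K M tau mu.
Hypothesis run : feedback_run xs ys C f g X_ T t kappa gamma K M Cm tau mu.

Lemma phase_of k : (k < horizon)%N ->
  exists2 l, (l <= T)%N & (start kappa l <= k < start kappa l.+1)%N.
Proof.
elim: T => [|T' ih] kT; first by exists 0%N => //; rewrite {1}/start big_ord0.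
have [kT'|kT'] := ltnP k (start kappa T'.+1).
  by have [l lT kl] := ih kT'; exists l => //; exact: leqW.
by exists T'.+1 => //; rewrite kT'.
Qed.

Lemma start_le_horizon l : (l <= T)%N -> (start kappa l.+1 <= horizon)%N.
Proof.
move=> lT; rewrite /start -!(big_mkord xpredT) [leqRHS](big_cat_nat (n := l.+1))//=.
exact: leq_addr.
Qed.

Lemma xs_idle i k : (k < horizon)%N -> ~ K i k -> xs i i k.+1 = xs i i k.
Proof.
move=> /phase_of[l lT kl] nK; rewrite (run_compute run i lT kl) ifF//.
by apply/negP => /set_mem.
Qed.

Lemma submxcol_xtrue k i : submxcol (x k) i = xs i i k.
Proof. exact: mxcolK. Qed.

Lemma submxcol_sstep k i : (k < horizon)%N -> submxcol (s k) i = xs i i k.+1 - xs i i k.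
Proof.
move=> kT; rewrite mxcolK; case: ifPn => // /negP kK.
by rewrite xs_idle ?subrr// => /mem_set.
Qed.

Lemma xs_in i k : (k <= horizon)%N -> X_ i (xs i i k).
Proof.
elim: k => [_|k ih kT]; first exact: (run_init run).
have [l lT kl] := phase_of kT; rewrite (run_compute run i lT kl).
by case: ifP => _; [exact: euclid_proj_in|exact: ih (ltnW kT)].
Qed.

Lemma xtrue_in k : (k <= horizon)%N -> X (x k).
Proof. by move=> kT i; rewrite submxcol_xtrue; exact: xs_in. Qed.

Lemma xs_telescope i a b : (a <= b <= horizon)%N ->
  xs i i b - xs i i a = \sum_(a <= k < b) submxcol (s k) i.
Proof.
move=> /andP[ab bT]; rewrite -(telescope_sumr (fun k => xs i i k) ab).
by apply: eq_big_nat => k /andP[_ kb]; rewrite submxcol_sstep// (leq_trans kb).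
Qed.

Lemma xtrueS k : (k < horizon)%N -> x k.+1 = x k + s k.
Proof.
move=> kT; apply/mxcolP => i.
by rewrite submxcolD !submxcol_xtrue submxcol_sstep// addrC subrK.
Qed.

Lemma xcopy_block i j k : (k <= horizon)%N ->
  exists2 k', (k.+1 - B <= k' <= k)%N & xs i j k = xs j j k'.
Proof.
move=> kT; have [->|ji] := eqVneq j i.
  by exists k => //; rewrite leqnn andbT leq_subLR -add1n leq_add2r.
exists (tau i j k); last exact: (run_delay_x run).
by case: PA => _ _ /(_ i j k) + _; rewrite max0n.
Qed.

Lemma xcopy_in i k : (k <= horizon)%N -> X (xcopy xs i k).
Proof.
move=> kT j; rewrite mxcolK; have [k' /andP[_ k'k] ->] := xcopy_block i j kT.
exact: xs_in (leq_trans k'k kT).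
Qed.

Lemma mu_bounds i j k : (k.+1 - B <= mu i j k <= k)%N.
Proof. by case: PA => _ _ _ /(_ i j k); rewrite max0n. Qed.

Lemma ycopy_in i k : (k <= horizon)%N -> stacked_outputs C X (ycopy ys i k).
Proof.
move=> kT j; exists (x (mu i j k)).
  by apply: xtrue_in; have /andP[_ h] := mu_bounds i j k; exact: leq_trans kT.
by rewrite mxcolK (run_delay_y run).
Qed.

Lemma enorm_xcopy_lag i k k' : (k <= k' <= horizon)%N ->
  enorm (x k' - xcopy xs i k) <= \sum_(k.+1 - B <= j < k') enorm (s j).
Proof.
move=> /andP[kk' kT]; have kT' := leq_trans kk' kT.
pose a_ j := s2val (cid2 (xcopy_block i j kT')).
have a_P j : (k.+1 - B <= a_ j <= k)%N /\ xs i j k = xs j j (a_ j).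
  by rewrite /a_; case: cid2.
apply: (enorm_delayed_sum (a_ := a_)) => [j|j]; first by have [/andP[]] := a_P j.
have [/andP[_ ak] eq_x] := a_P j.
rewrite submxcolB submxcol_xtrue mxcolK eq_x xs_telescope//.
by rewrite (leq_trans ak).
Qed.

Lemma enorm_ycopy_lag i k k' : (k <= k' <= horizon)%N ->
  enorm (C *m x k' - ycopy ys i k) <= c * \sum_(k.+1 - B <= j < k') enorm (s j).
Proof.
move=> /andP[kk' kT]; have kT' := leq_trans kk' kT.
rewrite mulr_sumr; apply: (@le_trans _ _ (\sum_(k.+1 - B <= j < k') enorm (C *m s j))).
  apply: (enorm_delayed_sum (a_ := fun j => mu i j k)) => j.
    by have /andP[] := mu_bounds i j k.
  have /andP[_ mk] := mu_bounds i j k.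
  rewrite submxcolB mxcolK (run_delay_y run)// -submxcol_mul -mulmxBr.
  rewrite (_ : x k' - x (mu i j k) = \sum_(mu i j k <= l < k') s l); last first.
    rewrite -(telescope_sumr (fun k => x k)) ?(leq_trans mk)//.
    apply: eq_big_nat => l /andP[_ lk]; rewrite xtrueS ?(leq_trans lk)//.
    by rewrite addrC addKr.
  by rewrite mulmx_sumr; apply: eq_bigr => l _; rewrite submxcol_mul.
by apply: ler_sum => j _; exact: enorm_mulmx.
Qed.

(** * Measured outputs *)

(** The output that agent i holds at time k is the one of time [u k]. Taking
    the larger of the times given by the delay bound and by the past
    measurements makes [u] nondecreasing, so that the intervals from [u k] to k
    are pairwise disjoint when k runs over the measurement times, besides being
    shorter than B. *)
Lemma measurement_times i : exists u : nat -> nat,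
  (forall k, (k <= horizon)%N ->
     (k.+1 - B <= u k <= k)%N /\ ys i i k = submxcol C i *m x (u k)) /\
  (forall k, (k < horizon)%N -> (u k <= u k.+1)%N /\ (M i k -> k <= u k.+1)%N).
Proof.
pose u := fix u k := if k is k'.+1 then
  maxn (mu i i k) (if k' \in M i then k' else u k') else 0%N.
have uS k : u k.+1 = maxn (mu i i k.+1) (if k \in M i then k else u k) by [].
exists u; suff uP k : (k <= horizon)%N ->
    (k.+1 - B <= u k <= k)%N /\ ys i i k = submxcol C i *m x (u k).
  split=> // k kT; rewrite uS; have [/andP[_ uk] _] := uP k (ltnW kT).
  split=> [|/mem_set ->]; last exact: leq_maxr.
  by rewrite leq_max; case: ifP => _; rewrite ?uk ?leqnn orbT.
elim: k => [_|k ih kT].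
  split; first by rewrite /u; lia.
  rewrite (run_delay_y run)//; congr (_ *m x _).
  by have /andP[_] := mu_bounds i i 0%N; rewrite leqn0 => /eqP.
have [/andP[_ uk] ysE] := ih (ltnW kT).
have mk := mu_bounds i i k.+1; rewrite uS; split.
  by case: ifP => _; lia.
have [_|_] := leqP (if k \in M i then k else u k) (mu i i k.+1).
  by rewrite (run_delay_y run).
rewrite (run_measure run)//; case: ifP => // _.
by rewrite /ytrue submxcol_mul.
Qed.

(** A measurement at time j changes the output held by agent i by the image of the
    displacement from [u j] to j; the intervals being disjoint, each step [s j] is
    charged at most once. The induction moves the right end of the charged
    range along [u]. *)
Lemma sum_qstep_le i a k : (a <= k <= horizon)%N ->
  \sum_(a <= j < k) enorm (submxcol (qstep ys M j) i) ^+ 2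
    <= (B.-1)%:R * c ^+ 2 * \sum_(a - B <= j < k) enorm (s j) ^+ 2.
Proof.
have [u [uP uS]] := measurement_times i.
set A := _%:R * _; have A0 : 0 <= A by rewrite mulr_ge0// sqr_ge0.
have sq0 j : 0 <= enorm (s j) ^+ 2 by exact: sqr_ge0.
have widen b d b' d' : (b' <= b)%N -> (d <= d')%N ->
    \sum_(b <= j < d) enorm (s j) ^+ 2 <= \sum_(b' <= j < d') enorm (s j) ^+ 2.
  move=> b'b dd'; have [bd|db] := leqP b d; last first.
    by rewrite big_geq ?(ltnW db)// sumr_ge0.
  rewrite [leRHS](big_cat_nat (n := b))//=; last exact: leq_trans dd'.
  rewrite [in leRHS](big_cat_nat (n := d) (m := b))//=.
  by rewrite addrCA lerDl addr_ge0// sumr_ge0.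
move=> /andP[ak kT].
suff potential : \sum_(a <= j < k) enorm (submxcol (qstep ys M j) i) ^+ 2
    <= A * \sum_(u a <= j < u k) enorm (s j) ^+ 2.
  apply: (le_trans potential); rewrite ler_wpM2l//; apply: widen.
    by have [] := uP a (leq_trans ak kT); lia.
  by have [/andP[]] := uP k kT.
elim: k ak kT => [|k ih]; first by rewrite leqn0 => /eqP -> _; rewrite !big_geq// mulr0.
rewrite leq_eqVlt => /predU1P[-> _|]; first by rewrite !big_geq// mulr0.
rewrite ltnS => ak kT; have {}ih := ih ak (ltnW kT).
rewrite big_nat_recr//= mxcolK.
have [ukS MkS] := uS k kT; have [/andP[u1 u2] ysE] := uP k (ltnW kT).
have ua : (u a <= u k)%N.
  move: ak kT {ih ukS MkS u1 u2 ysE}; elim: k => [|k ih]; first by rewrite leqn0 => /eqP ->.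
  rewrite leq_eqVlt => /predU1P[-> //|]; rewrite ltnS => ak kT.
  by apply: leq_trans (ih ak (ltnW kT)) _; case: (uS k (ltnW kT)).
case: ifPn => [/set_mem Mk|_]; last first.
  rewrite enorm0 expr2 mul0r addr0; apply: (le_trans ih); rewrite ler_wpM2l//.
  exact: widen.
rewrite (run_measure run)// mem_set// ysE /ytrue -submxcol_mul -mulmxBr.
have jump : enorm (submxcol C i *m (x k - x (u k))) ^+ 2
    <= A * \sum_(u k <= j < k) enorm (s j) ^+ 2.
  rewrite submxcol_mul.
  apply: (@le_trans _ _ ((c * \sum_(u k <= j < k) enorm (s j)) ^+ 2)).
    rewrite ler_pXn2r ?nnegrE ?enorm_ge0//; last first.
      by rewrite mulr_ge0 ?opnorm_ge0// sumr_ge0// => j _; exact: enorm_ge0.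
    apply: (le_trans (enorm_submxcol _ _)); apply: (le_trans (enorm_mulmx _ _)).
    rewrite ler_wpM2l ?opnorm_ge0//; rewrite -(telescope_sumr (fun k => x k))//.
    rewrite (eq_big_nat _ _ (F2 := s)); first exact: enorm_sum.
    by move=> j /andP[_ jk]; rewrite xtrueS ?(leq_trans jk) ?(ltnW kT)// addrC addKr.
  rewrite exprMn /A [leRHS]mulrAC [leRHS]mulrC ler_wpM2l ?sqr_ge0//.
  apply: (le_trans (sqr_sumr_le _ _ _)); rewrite ler_wpM2r ?sumr_ge0// ler_nat; lia.
apply: (le_trans (lerD ih jump)); rewrite -mulrDr ler_wpM2l//.
by rewrite -big_cat_nat//=; apply: widen => //; exact: MkS.
Qed.

Lemma delta_le k : (k + B <= horizon)%N ->
  delta ys B M (k + B) <= N%:R * ((B.-1)%:R * c ^+ 2 * (beta xs B K k + beta xs B K (k + B))).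
Proof.
move=> kT; rewrite /delta addnK.
rewrite (eq_bigr (fun j => \sum_i enorm (submxcol (qstep ys M j) i) ^+ 2)); last first.
  by move=> j _; rewrite -sqr_enorm_mxcol submxcolK.
rewrite exchange_big/= -[N in N%:R]card_ord mulr_natl -sumr_const; apply: ler_sum => i _.
apply: le_trans (sum_qstep_le i _) _; first by rewrite leq_addr.
by rewrite /beta addnK -big_cat_nat//=; lia.
Qed.

(** * One objective *)

Section Phase.
Variables (l : nat) (p Lx Ly lam : R).
Hypothesis lT : (l <= T)%N.
Local Notation tl := (t l).
Local Notation gam := (gamma l).
Local Notation H := (Lx + c ^+ 2 * Ly).
Local Notation hgrad z := (grad_x_J C f g z (C *m z) tl).
Local Notation obj z := (J f g z (C *m z) tl).
Local Notation xopt := (xstar C X f g tl).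
Local Notation agrad i k := (grad_xi_J C f g i (xcopy xs i k) (ycopy ys i k) tl).

Hypotheses (p_ge0 : 0 <= p) (Lx_ge0 : 0 <= Lx) (Ly_ge0 : 0 <= Ly).
Hypotheses (f_diff : forall z, differentiable (f ^~ tl) z)
  (g_diff : forall z, differentiable (g ^~ tl) z)
  (f_conv : strongly_convex p (f ^~ tl)) (g_conv : strongly_convex p (g ^~ tl)).
Hypotheses (f_lip : lipschitz_const Lx X (grad (f ^~ tl)))
  (g_lip : lipschitz_const Ly (stacked_outputs C X) (grad (g ^~ tl))).
Hypotheses (gam_gt0 : 0 < gam) (gam_le1 : gam <= 1).

Lemma obj_gradient_le z w : obj z - obj w <= dot (hgrad z) (z - w).
Proof.
rewrite /J /grad_x_J dotDl dot_mulmx mulmxBr.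
have h1 := convex_gradient_le w p_ge0 f_conv (f_diff z).
have h2 := convex_gradient_le (C *m w) p_ge0 g_conv (g_diff (C *m z)).
lra.
Qed.

Lemma xstar_argmin : argmin_set (fun z => obj z) X xopt.
Proof.
apply: argmin_compact.
- exact: prod_set_nonempty.
- exact: prod_set_compact.
move=> z; rewrite /J; apply: (@continuousD _ _ _ (f ^~ tl) (fun z => g (C *m z) tl)).
  exact: differentiable_continuous.
apply: (@continuous_comp _ _ _ (fun z => C *m z) (g ^~ tl)).
  exact: mulmx_continuous.
exact: differentiable_continuous.
Qed.

Lemma grad_xi_JE i z y : grad_xi_J C f g i z y tl = submxcol (grad_x_J C f g z y tl) i.
Proof.
rewrite /grad_xi_J /grad_x_J submxcolD; congr (_ + _).
by rewrite -submxcol_mul; congr (_ *m _); apply/matrixP => a b; rewrite !mxE.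
Qed.

(** The delays enter only through the distance travelled during the last B
    steps. *)
Lemma enorm_gradient_lag i k k' : (k <= k' <= horizon)%N ->
  enorm (submxcol (hgrad (x k')) i - agrad i k)
    <= H * \sum_(k.+1 - B <= j < k') enorm (s j).
Proof.
move=> kk'; have /andP[k1 k2] := kk'; have kT := leq_trans k1 k2.
rewrite grad_xi_JE -submxcolB; apply: (le_trans (enorm_submxcol _ _)).
set W := \sum_(_ <= j < _) _.
rewrite /grad_x_J opprD addrACA -mulmxBr; apply: (le_trans (enormD _ _)).
rewrite mulrDl lerD//.
  apply: le_trans (f_lip _ _) _; [exact: xtrue_in|exact: xcopy_in|].
  by rewrite ler_wpM2l//; exact: enorm_xcopy_lag.
apply: (le_trans (enorm_trmulmx _ _)); rewrite expr2 -!mulrA ler_wpM2l ?opnorm_ge0//.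
apply: le_trans (g_lip _ (ycopy_in i kT)) _.
  by move=> j; exists (x k'); [exact: xtrue_in|rewrite submxcol_mul].
by rewrite mulrCA ler_wpM2l//; exact: enorm_ycopy_lag.
Qed.

Lemma compute_dot_le0 i k w : (start kappa l <= k < start kappa l.+1)%N ->
  K i k -> X_ i w ->
  dot (xs i i k - gam *: agrad i k - xs i i k.+1) (w - xs i i k.+1) <= 0.
Proof.
move=> kl /mem_set kK Xw; rewrite (run_compute run i lT kl) kK.
exact: euclid_proj_dot_le0.
Qed.

(** Convexity is used at the new point, which avoids any second-order expansion.
    The projection gives [<agrad, s> <= - |s|^2 / gam] block by block, and the lag
    of the gradient is split by Young's inequality into the B latest steps. *)
Lemma step_descent k : (start kappa l <= k < start kappa l.+1)%N ->
  obj (x k.+1) - obj (x k) <=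
    (2^-1 * (H * B%:R) - gam^-1) * enorm (s k) ^+ 2
    + 2^-1 * (H * N%:R) * \sum_(k.+1 - B <= j < k.+1) enorm (s j) ^+ 2.
Proof.
move=> kl; have kT : (k < horizon)%N.
  by have /andP[_ h] := kl; exact: leq_trans (start_le_horizon lT).
have H0 : 0 <= H by rewrite addr_ge0// mulr_ge0// sqr_ge0.
apply: (le_trans (obj_gradient_le _ _)); rewrite xtrueS// [x k + s k - x k]addrC addKr.
rewrite -xtrueS// dot_submxcol.
set S2 := \sum_(_ <= j < _) _.
have S20 : 0 <= S2 by rewrite sumr_ge0// => j _; exact: sqr_ge0.
have -> : enorm (s k) ^+ 2 = \sum_i enorm (submxcol (s k) i) ^+ 2.
  by rewrite -sqr_enorm_mxcol submxcolK.
have -> : (2^-1 * (H * B%:R) - gam^-1) * (\sum_i enorm (submxcol (s k) i) ^+ 2)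
    + 2^-1 * (H * N%:R) * S2 =
  \sum_i ((2^-1 * (H * B%:R) - gam^-1) * enorm (submxcol (s k) i) ^+ 2 + 2^-1 * H * S2).
  by rewrite big_split/= -mulr_sumr sumr_const card_ord -mulr_natr; ring.
apply: ler_sum => i _.
have [kK|nK] := pselect (K i k); last first.
  rewrite submxcol_sstep// xs_idle// subrr enorm0 expr0n mulr0 add0r /dot mulmx0 mxE.
  by rewrite !mulr_ge0.
set si := submxcol (s k) i.
have proj : dot (agrad i k) si <= - gam^-1 * enorm si ^+ 2.
  have := compute_dot_le0 kl kK (xs_in i (ltnW kT)).
  have -> : xs i i k - gam *: agrad i k - xs i i k.+1 = - (si + gam *: agrad i k).
    by rewrite /si submxcol_sstep// opprD opprB addrAC.
  have -> : xs i i k - xs i i k.+1 = - si by rewrite /si submxcol_sstep// opprB.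
  rewrite dotNl dotNr opprK dotDl dotZl -sqr_enorm => h.
  rewrite -(ler_pM2l gam_gt0) mulrA mulrN divff ?lt0r_neq0// mulN1r; lra.
have lag : dot (submxcol (hgrad (x k.+1)) i - agrad i k) si <=
    2^-1 * (H * B%:R) * enorm si ^+ 2 + 2^-1 * H * S2.
  apply: (le_trans (cauchy_schwarz _ _)).
  apply: (@le_trans _ _ ((H * \sum_(k.+1 - B <= j < k.+1) enorm (s j)) * enorm si)).
    by rewrite ler_wpM2r ?enorm_ge0//; apply: enorm_gradient_lag; rewrite leqnSn.
  rewrite -mulrA mulr_suml.
  have young : \sum_(k.+1 - B <= j < k.+1) enorm (s j) * enorm si <=
      2^-1 * (B%:R * enorm si ^+ 2 + S2).
    apply: (@le_trans _ _ (\sum_(k.+1 - B <= j < k.+1)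
      (2^-1 * enorm si ^+ 2 + 2^-1 * enorm (s j) ^+ 2))).
      by apply: ler_sum => j _; have := sqr_ge0 (enorm (s j) - enorm si); lra.
    rewrite big_split/= mulrDr lerD//; last by rewrite mulr_sumr.
    rewrite sumr_const_nat -[leLHS]mulr_natl mulrCA ler_wpM2l//.
    by rewrite ler_wpM2r ?sqr_ge0// ler_nat; lia.
  have := ler_wpM2l H0 young; lra.
by move: lag; rewrite dotBl; move: proj; lra.
Qed.

Section Window.
Variable k0 : nat.
Hypothesis window : (start kappa l <= k0)%N /\ (k0 + B <= start kappa l.+1)%N.
Local Notation b0 := (beta xs B K k0).
Local Notation b1 := (beta xs B K (k0 + B)).

Let window_in k : (k0 <= k < k0 + B)%N -> (start kappa l <= k < start kappa l.+1)%N.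
Proof. by case: window => h1 h2; lia. Qed.

Let window_horizon : (k0 + B <= horizon)%N.
Proof. exact: leq_trans (proj2 window) (start_le_horizon lT). Qed.

Let sum_two_windows (F : nat -> R) :
  \sum_(k0 - B <= j < k0 + B) F j = \sum_(k0 - B <= j < k0) F j + \sum_(k0 <= j < k0 + B) F j.
Proof. by rewrite (big_cat_nat (n := k0))//=; lia. Qed.

Let window_arith k : (k0 <= k < k0 + B)%N ->
  [/\ k0 - B <= k.+1 - B, k.+1 - B <= k.+1, k.+1 - B <= k0 + B, k.+1 <= k0 + B
    & k0 + B - (k.+1 - B) <= 2 * B]%N.
Proof. by move=> /andP[h1 h2]; split; lia. Qed.

Let b1E : b1 = \sum_(k0 <= j < k0 + B) enorm (s j) ^+ 2.
Proof. by rewrite /beta addnK. Qed.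

(** Each step of the two windows occurs in at most B of the sums of [step_descent]. *)
Lemma window_descent :
  obj (x (k0 + B)) - obj (x k0) <=
    (2^-1 * (B%:R + N%:R * B%:R) * H - gam^-1) * b1
    + 2^-1 * (N%:R * B%:R * H) * b0.
Proof.
have H0 : 0 <= H by rewrite addr_ge0// mulr_ge0// sqr_ge0.
have k0B : (k0 <= k0 + B)%N by exact: leq_addr.
rewrite -(telescope_sumr (fun k => obj (x k)) k0B).
have step k : (k0 <= k < k0 + B)%N -> obj (x k.+1) - obj (x k) <=
   (2^-1 * (H * B%:R) - gam^-1) * enorm (s k) ^+ 2 + 2^-1 * (H * N%:R) * (b0 + b1).
  move=> kw; have [w1 w2 w3 w4 _] := window_arith kw.
  apply: (le_trans (step_descent (window_in kw))); rewrite lerD2l ler_wpM2l//.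
    by rewrite !mulr_ge0.
  rewrite b1E /beta -sum_two_windows [leRHS](big_cat_nat (n := (k.+1 - B)%N))//=.
  rewrite ler_wpDl ?sumr_ge0// => [j _|]; first exact: sqr_ge0.
  rewrite [leRHS](big_cat_nat (n := k.+1))//=.
  by rewrite lerDl sumr_ge0// => j _; exact: sqr_ge0.
apply: (le_trans (ler_sum_nat step)).
rewrite big_split/= -mulr_sumr -b1E sumr_const_nat addKn -mulr_natr; lra.
Qed.

Lemma last_compute i : exists2 k, (k0 <= k < k0 + B)%N /\ K i k & xs i i (k0 + B) = xs i i k.+1.
Proof.
have [computes _ _ _] := PA; have := computes i k0.
have := window_horizon; elim: B => [_ [k]|d ih]; first by rewrite addn0; lia.
rewrite addnS => dT [k kd Kk].
have [Kd|nKd] := pselect (K i (k0 + d)%N).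
  by exists (k0 + d)%N => //; split=> //; lia.
have kd' : (k0 <= k < k0 + d)%N.
  by have : k != (k0 + d)%N by [apply: contra_notN nKd => /eqP <-]; lia.
have [|k' [k'd Kk'] eq_xs] := ih (ltnW dT); first by exists k.
by exists k'; [split=> //; lia|rewrite xs_idle].
Qed.

Section ErrorBound.
Hypothesis error_bound : forall z ga, X z -> 0 < ga ->
  enorm (z - xopt) <= lam * Num.max 1 ga^-1 * enorm (z - euclid_proj X (z - ga *: hgrad z)).
Hypothesis lam_ge0 : 0 <= lam.

(** At the end of a window, block i is the outcome of the last computation of
    agent i in that window. Hence the final point is the projection of
    [xK - sh - gam gh], where [sh] stacks the corresponding steps and [gh] the
    delayed gradients; this point differs from the argument of an exact projected
    gradient step at [xK] by [gam (hgrad xK - gh) - sh]. This residual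
    bounds the distance to the optimum through the error bound, and the
    directional derivative through the variational inequality. *)
Lemma window_error_bound :
  obj (x (k0 + B)) - obj xopt <=
    lam / gam ^+ 2 * (2 * b1 + 4 * (gam ^+ 2 * (N%:R * B%:R * H ^+ 2)) * (b1 + b0)).
Proof.
have H0 : 0 <= H by rewrite addr_ge0// mulr_ge0// sqr_ge0.
pose kk i := s2val (cid2 (last_compute i)).
have kkP i : ((k0 <= kk i < k0 + B)%N /\ K i (kk i)) /\ xs i i (k0 + B) = xs i i (kk i).+1.
  by rewrite /kk; case: cid2.
set xK := x (k0 + B).
have XxK : X xK by exact: xtrue_in window_horizon.
pose sh : 'cV[R]_n := \mxcol_i submxcol (s (kk i)) i.
pose gh : 'cV[R]_n := \mxcol_i agrad i (kk i).
pose res := gam *: (hgrad xK - gh) - sh.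
have [Xopt _] := xstar_argmin.
have var w : X w -> dot (xK - sh - gam *: gh - xK) (w - xK) <= 0.
  move=> Xw; rewrite dot_submxcol; apply: sumr_le0 => i _.
  have [[kw Kk] eq_xs] := kkP i.
  have := compute_dot_le0 (window_in kw) Kk (Xw i).
  have kT : (kk i < horizon)%N by have := window_horizon; lia.
  rewrite !submxcolB submxcol_xtrue eq_xs mxcolK submxcol_sstep//.
  rewrite (_ : submxcol (gam *: gh) i = gam *: agrad i (kk i)); last first.
    by rewrite /gh; apply/matrixP => a b; rewrite -(mxcolK (fun j => agrad j (kk j)) i) !mxE.
  by rewrite opprB [_ + (_ - _)]addrC subrK.
have obj_res : gam * (obj xK - obj xopt) <= enorm res * enorm (xK - xopt).
  have h1 := obj_gradient_le xK xopt.
  have h2 := var _ Xopt.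
  apply: le_trans (cauchy_schwarz _ _).
  apply: (@le_trans _ _ (gam * dot (hgrad xK) (xK - xopt))); first by rewrite ler_wpM2l// ltW.
  move: h2; rewrite (_ : xK - sh - gam *: gh - xK = - (sh + gam *: gh)); last first.
    by rewrite opprD addrAC [xK - sh]addrC addrK.
  rewrite -[xopt - xK]opprB dotNl dotNr opprK dotDl dotZl => h2.
  by rewrite /res dotBl dotZl dotBl; lra.
have dist_res : enorm (xK - xopt) <= lam / gam * enorm res.
  apply: (le_trans (error_bound XxK gam_gt0)).
  rewrite max_r ?invf_ge1// ler_wpM2l ?divr_ge0 ?(ltW gam_gt0)//.
  have -> : res = (xK - sh - gam *: gh) - (xK - gam *: hgrad xK).
    by rewrite /res scalerBr; apply/matrixP => a b; rewrite !mxE; ring.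
  apply: le_enorm_of_dot_le0.
    by apply: var; apply: euclid_proj_in; [exact: prod_set_nonempty|exact: prod_set_compact].
  apply: euclid_proj_dot_le0 => //;
    by [exact: prod_set_nonempty|exact: prod_set_compact|exact: prod_set_convex].
have res_sqr : enorm res ^+ 2 <= 2 * enorm sh ^+ 2 + 2 * gam ^+ 2 * enorm (hgrad xK - gh) ^+ 2.
  rewrite /res [leLHS]sqr_enormD enormN dotNr enormZ exprMn real_normK ?num_real// dotZl.
  have := dot_ge0 (gam *: (hgrad xK - gh) + sh).
  rewrite -sqr_enorm [enorm (_ + sh) ^+ 2]sqr_enormD enormZ exprMn.
  by rewrite real_normK ?num_real// dotZl; lra.
have sh_le : enorm sh ^+ 2 <= b1.
  rewrite /sh sqr_enorm_mxcol b1E.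
  rewrite (eq_bigr (fun j => \sum_i enorm (submxcol (s j) i) ^+ 2)); last first.
    by move=> j _; rewrite -sqr_enorm_mxcol submxcolK.
  rewrite exchange_big/=; apply: ler_sum => i _; have [[kw _] _] := kkP i.
  have /andP[w1 w2] := kw.
  rewrite (big_cat_nat (n := kk i))//=; last exact: ltnW.
  rewrite (big_cat_nat (n := (kk i).+1) (m := kk i))//=.
  by rewrite big_nat1 addrCA lerDl addr_ge0// sumr_ge0// => j _; exact: sqr_ge0.
have gh_le : enorm (hgrad xK - gh) ^+ 2 <= N%:R * (H ^+ 2 * (2 * B%:R * (b1 + b0))).
  rewrite -[hgrad xK - gh]submxcolK sqr_enorm_mxcol.
  rewrite -[N in N%:R]card_ord mulr_natl -sumr_const; apply: ler_sum => i _.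
  have [[kw _] _] := kkP i; have [w1 _ w3 w4 w5] := window_arith kw.
  apply: (@le_trans _ _ ((H * \sum_((kk i).+1 - B <= j < k0 + B) enorm (s j)) ^+ 2)).
    rewrite ler_pXn2r ?nnegrE ?enorm_ge0//; last first.
      by rewrite mulr_ge0// sumr_ge0// => j _; exact: enorm_ge0.
    rewrite submxcolB mxcolK; apply: enorm_gradient_lag.
    by rewrite window_horizon andbT ltnW.
  rewrite exprMn ler_wpM2l ?sqr_ge0//; apply: (le_trans (sqr_sumr_le _ _ _)).
  apply: ler_pM => //; first by rewrite sumr_ge0// => j _; exact: sqr_ge0.
    by rewrite -natrM ler_nat.
  rewrite addrC b1E /beta -sum_two_windows [leRHS](big_cat_nat (n := ((kk i).+1 - B)%N))//=.
  by rewrite lerDr sumr_ge0// => j _; exact: sqr_ge0.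
rewrite -(ler_pM2l gam_gt0); apply: (le_trans obj_res).
apply: (@le_trans _ _ (enorm res * (lam / gam * enorm res))).
  by rewrite ler_wpM2l ?enorm_ge0.
rewrite mulrCA -expr2 [leRHS]mulrA (_ : gam * (lam / gam ^+ 2) = lam / gam); last first.
  by field; rewrite lt0r_neq0.
rewrite ler_wpM2l ?divr_ge0 ?(ltW gam_gt0)//; apply: (le_trans res_sqr).
have := ler_wpM2l (mulr_ge0 (ler0n R 2) (sqr_ge0 gam)) gh_le; lra.
Qed.

End ErrorBound.
End Window.

(** The windows of one objective satisfy the hypotheses of [coupled_decay]: the lag
    contributes [eps = 4 gam^2 N B H^2 <= 16 (gam E)^2], which is tiny. *)
Lemma phase_decay (r : nat) (D E F a b : R)
    (q := D / (2 * F + 2 * D)) (rh := 1 - gam * q)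
    (al := fun k => alpha xs C f g X tl (start kappa l + k * B)%N)
    (be := fun k => beta xs B K (start kappa l + k * B)%N) :
  (forall z ga, X z -> 0 < ga ->
     enorm (z - xopt) <= lam * Num.max 1 ga^-1 * enorm (z - euclid_proj X (z - ga *: hgrad z))) ->
  0 <= lam -> (start kappa l + r * B <= start kappa l.+1)%N ->
  gam <= 2^-1 -> 0 < D <= 1 -> 0 <= E -> 104 * (gam * E) <= D ->
  15 / 2 * lam ^+ 2 + 13 <= F ->
  D / gam - E <= gam^-1 - 2^-1 * (B%:R + N%:R * B%:R) * H ->
  (0 < N)%N -> N%:R * B%:R * H <= 2 * E ->
  0 <= rh -> a + E * b <= (D / gam - E) * rh * b ->
  al 0%N + E * be 0%N <= a -> be 1%N <= b ->
  forall k, (k < r)%N -> al k.+1 <= a * rh ^+ k /\ be k.+1 <= b * rh ^+ k.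
Proof.
move=> error_bound lam_ge0 rl gam2 /andP[D0 D1] E0 gE lF coef N0 NBH rh0 margin init be1.
have H0 : 0 <= H by rewrite addr_ge0// mulr_ge0// sqr_ge0.
(* beyond the horizon the sequences are frozen, so that they stay nonnegative *)
pose al' k := al (minn k r); pose be' k := be (minn k r).
have be0 k : 0 <= be' k by rewrite sumr_ge0// => j _; exact: sqr_ge0.
have al0 k : 0 <= al' k.
  have [_ xmin] := xstar_argmin; rewrite /al' /al /alpha subr_ge0; apply: xmin.
  apply: xtrue_in; apply: leq_trans (start_le_horizon lT); apply: leq_trans rl.
  by rewrite leq_add2l leq_mul2r geq_minr orbT.
have win k : (k < r)%N -> (start kappa l <= start kappa l + k * B)%N /\
    (start kappa l + k * B + B <= start kappa l.+1)%N.
  move=> kr; split; first exact: leq_addr.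
  by apply: leq_trans rl; rewrite -addnA -mulSnr leq_add2l leq_mul2r kr orbT.
have alE k : (k <= r)%N -> al' k = al k by move=> kr; rewrite /al' (minn_idPl kr).
have beE k : (k <= r)%N -> be' k = be k by move=> kr; rewrite /be' (minn_idPl kr).
have nextE k : (start kappa l + k * B + B = start kappa l + k.+1 * B)%N.
  by rewrite mulSnr addnA.
have descent k : (k < r)%N ->
    al' k.+1 + (D / gam - E) * be' k.+1 <= al' k + E * be' k.
  move=> kr; have h := window_descent (win _ kr).
  have h1 : (D / gam - E) * be' k.+1 <= (gam^-1 - 2^-1 * (B%:R + N%:R * B%:R) * H) * be' k.+1.
    by rewrite ler_wpM2r.
  have h2 : 2^-1 * (N%:R * B%:R * H) * be' k <= E * be' k by rewrite ler_wpM2r//; lra.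
  move: h1 h2 h; rewrite !alE ?beE ?(ltnW kr)// nextE -/(be _) -/(be _).
  by rewrite /al /alpha /ytrue /ystar; lra.
pose eps := 4 * (gam ^+ 2 * (N%:R * B%:R * H ^+ 2)).
have eps_bounds : 0 <= eps <= 100^-1.
  have NB1 : 1 <= (N%:R * B%:R : R) by rewrite -natrM ler1n muln_gt0 N0.
  apply/andP; split.
    by rewrite /eps mulr_ge0// mulr_ge0 ?sqr_ge0// mulr_ge0 ?sqr_ge0// mulr_ge0.
  have NBH0 : 0 <= N%:R * B%:R * H by rewrite mulr_ge0// mulr_ge0.
  have h1 : N%:R * B%:R * H ^+ 2 <= (2 * E) ^+ 2.
    apply: (@le_trans _ _ ((N%:R * B%:R * H) ^+ 2)).
      by rewrite [in leRHS]exprMn ler_wpM2r ?sqr_ge0// expr2 ler_peMr//; lra.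
    by rewrite ler_pXn2r// nnegrE// mulr_ge0.
  have h2 : (104 * (gam * E)) ^+ 2 <= 1.
    rewrite -[leRHS](expr1n _ 2) ler_pXn2r ?nnegrE//; first exact: le_trans gE D1.
    by rewrite mulr_ge0// mulr_ge0// ltW.
  have h3 : gam ^+ 2 * (N%:R * B%:R * H ^+ 2) <= gam ^+ 2 * (2 * E) ^+ 2.
    by rewrite ler_wpM2l// sqr_ge0.
  by rewrite /eps; lra.
have errbnd k : (k < r)%N ->
    al' k.+1 <= lam / gam ^+ 2 * (2 * be' k.+1 + eps * (be' k.+1 + be' k)).
  move=> kr; rewrite alE// !beE ?(ltnW kr)//.
  by have := window_error_bound (win _ kr) error_bound lam_ge0; rewrite nextE.
have g2 : 0 < gam <= 2^-1 by rewrite gam_gt0.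
have D01 : 0 < D <= 1 by rewrite D0.
have decay := coupled_decay g2 D01 E0 gE lam_ge0 lF eps_bounds al0 be0 descent errbnd.
have al_le k : (k < r)%N -> al' k.+1 <= a * rh ^+ k.
  move=> kr; have := decay k kr; rewrite -/q -/rh => h.
  apply: (@le_trans _ _ (al' k.+1 + D / gam / 4 * be' k.+1)).
    by rewrite lerDl mulr_ge0// divr_ge0// divr_ge0// ltW.
  apply: (le_trans h); rewrite ler_wpM2r ?exprn_ge0//.
  by rewrite alE// beE.
have Eu : E < D / gam by rewrite ltr_pdivlMr//; lra.
move=> k kr; rewrite -alE// -beE//; split; first exact: al_le.
apply: (coupled_decay_snd rh0 E0 Eu margin al0 descent al_le) => //.
by rewrite beE//; exact: leq_ltn_trans kr.
Qed.

End Phase.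
End Trajectory.

(** * From one objective to the next *)

(** The bound on the measurement jumps involves two consecutive windows. The older one
    is larger by a factor 1 / rh at most, and [(B - 1) (1 + 1 / rh) <= B^2] for all
    B as soon as [rh >= 3 / 4]. *)
Lemma two_window_rate (R : realType) (B : nat) (rh b x y : R) k :
  (0 < B)%N -> 3 / 4 <= rh <= 1 -> 0 <= b ->
  x <= b * rh ^+ (k - 1)%N -> y <= b * rh ^+ k ->
  (B.-1)%:R * (x + y) <= B%:R ^+ 2 * (b * rh ^+ k).
Proof.
move=> B0 /andP[r34 r1] b0 xb yb.
have rh0 : 0 < rh by lra.
have z0 : 0 <= b * rh ^+ k by rewrite mulr_ge0// exprn_ge0// ltW.
have rx : rh * x <= b * rh ^+ k.
  apply: (@le_trans _ _ (rh * (b * rh ^+ (k - 1)%N))); first by rewrite ler_wpM2l// ltW.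
  case: k {xb yb z0} => [|k]; first by rewrite !mulr1 ler_piMl.
  by rewrite subn1/= exprS mulrCA.
have B1 : (B.-1)%:R = B%:R - 1 :> R by rewrite -subn1 natrB.
have B1' : 1 <= B%:R :> R by rewrite ler1n.
rewrite -(ler_pM2l rh0); set z := b * rh ^+ k in z0 rx yb *.
have h1 : rh * (x + y) <= (1 + rh) * z.
  have : rh * y <= rh * z by rewrite ler_wpM2l// ltW.
  lra.
have h2 : (B.-1)%:R * (rh * (x + y)) <= (B.-1)%:R * ((1 + rh) * z) by rewrite ler_wpM2l.
have h3 : (B.-1)%:R * (1 + rh) <= rh * B%:R ^+ 2.
  have : 0 <= (rh - 3 / 4) * (B%:R ^+ 2 - B%:R + 1).
    by rewrite mulr_ge0 ?subr_ge0//; have := sqr_ge0 (B%:R - 1 : R); lra.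
  by rewrite B1; have := sqr_ge0 (B%:R - 7 / 6 : R); lra.
have h4 : (B.-1)%:R * (1 + rh) * z <= rh * B%:R ^+ 2 * z by rewrite ler_wpM2r.
lra.
Qed.

Lemma startS kappa l : start kappa l.+1 = (start kappa l + kappa l)%N.
Proof. by rewrite /start big_ord_recr. Qed.

Unset Implicit Arguments.

Theorem theorem2 (R : realType) (N : nat) (n_ m_ : 'I_N -> nat)
  (C : 'M[R]_((\sum_i m_ i)%N, (\sum_i n_ i)%N))
  (X_ : forall i : 'I_N, set 'cV[R]_(n_ i))
  (f : 'cV[R]_(\sum_i n_ i)%N -> nat -> R)
  (g : 'cV[R]_(\sum_i m_ i)%N -> nat -> R)
  (T : nat) (t : nat -> nat) (B : nat) (kappa r : nat -> nat)
  (p lam Lt Delta : R) (sigma Lx Ly Mx My LJ L gamma : nat -> R)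
  (K M : 'I_N -> set nat) (Cm : 'I_N -> 'I_N -> set nat)
  (tau mu : 'I_N -> 'I_N -> nat -> nat)
  (xs : forall i j : 'I_N, nat -> 'cV[R]_(n_ j))
  (ys : forall i j : 'I_N, nat -> 'cV[R]_(m_ j)) :
  let X := prod_set X_ in
  let Y := outputs C X in
  let P := {| c_N := N; c_B := B; c_m := (\sum_i m_ i)%N;
              c_C := opnorm C; c_diam := ediam X;
              c_lam := lam; c_Lt := Lt; c_Delta := Delta; c_sigma := sigma;
              c_Lx := Lx; c_Ly := Ly; c_Mx := Mx; c_My := My;
              c_LJ := LJ; c_L := L; c_r := r; c_gamma := gamma |} in
  (0 < N)%N -> (forall i, 0 < n_ i)%N -> (forall i, 0 < m_ i)%N ->
  (0 < T)%N -> (0 < B)%N ->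
  (* smoothness and strong convexity *)
  0 < p ->
  (forall l, (l <= T)%N ->
     [/\ C2 (f ^~ (t l)), C2 (g ^~ (t l)),
         strongly_convex p (f ^~ (t l)) & strongly_convex p (g ^~ (t l))]) ->
  (* constraint sets *)
  (forall i, [/\ X_ i !=set0, compact (X_ i) & polyhedral (X_ i)]) ->
  (* time variation *)
  0 < Lt -> 0 < Delta -> (forall l, (l < T)%N -> 0 < sigma l.+1) ->
  (forall l, (l < T)%N ->
     [/\ enorm (xstar C X f g (t l.+1) - xstar C X f g (t l)) <= sigma l.+1,
         (forall x y, X x -> Y y ->
            `|J f g x y (t l.+1) - J f g x y (t l)|
              <= Lt * `|(t l.+1)%:R - (t l)%:R|)
       & `|(t l.+1)%:R - (t l)%:R| <= Delta]) ->
  (* number of ticks for each objective *)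
  (forall l, (l <= T)%N -> (1 <= kappa l)%N /\ kappa l = (r l * B)%N) ->
  partial_asynchrony B K M tau mu ->
  (* curvature bounds, Lipschitz constants of the gradients *)
  (forall l, (l <= T)%N -> 0 < Lx l /\ 0 < Ly l) ->
  (forall l, (l <= T)%N ->
     [/\ (forall x, X x -> opnorm (hess (f ^~ (t l)) x) <= Lx l),
         (forall y, Y y -> opnorm (hess (g ^~ (t l)) y) <= Ly l),
         lipschitz_const (Lx l) X (grad (f ^~ (t l)))
       & lipschitz_const (Ly l) (stacked_outputs C X) (grad (g ^~ (t l)))]) ->
  (* gradient bounds *)
  (forall l, (l <= T)%N ->
     [/\ 0 < Mx l, 0 < My l,
         (forall x, X x -> enorm (grad (f ^~ (t l)) x) <= Mx l)
       & (forall y, Y y -> enorm (grad (g ^~ (t l)) y) <= My l)]) ->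
  (* Lipschitz constants of the objective and of its input gradient *)
  (forall l, (l <= T)%N -> 0 < LJ l /\ 0 < L l) ->
  (forall l, (l <= T)%N -> forall x x' y y', X x -> X x' -> Y y -> Y y' ->
     `|J f g x y (t l) - J f g x' y' (t l)|
       <= LJ l * enorm (col_mx (x - x') (y - y'))
     /\ enorm (grad_x_J C f g x y (t l) - grad_x_J C f g x' y' (t l))
       <= L l * enorm (col_mx (x - x') (y - y'))) ->
  (* error bound *)
  0 < lam ->
  (forall l, (l <= T)%N -> forall x gam, X x -> 0 < gam ->
     enorm (x - xstar C X f g (t l))
       <= lam * Num.max 1 gam^-1
          * enorm (x - euclid_proj X (x - gam *: grad_x_J C f g x (C *m x) (t l)))) ->
  (forall l, (l <= T)%N ->
     2 / (B%:R * (Lx l + Ly l * opnorm C ^+ 2)) <= 1) ->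
  (forall l, (l <= T)%N -> 0 < gamma l < gamma_max P l) ->
  feedback_run xs ys C f g X_ T t kappa gamma K M Cm tau mu ->
  forall l, (l <= T)%N ->
    [/\ 0 < rho P l < 1,
        alpha xs C f g X (t l) (start kappa l + r l * B)%N
          <= al P l * rho P l ^+ (r l - 1)%N,
        beta xs B K (start kappa l + r l * B)%N
          <= bl P l * rho P l ^+ (r l - 1)%N
      & delta ys B M (start kappa l + r l * B)%N
          <= dl P l * rho P l ^+ (r l - 1)%N].
Proof.
move=> X Y P N0 n0 m0 T0 B0 p0 smooth sets Lt0 Delta0 sigma0 variation ticks PA curv lips
  gbounds LJL0 lipJ lam0 error_bound step_bound gam_bounds run.
have X_ne i : X_ i !=set0 by case: (sets i).
have X_cpt i : compact (X_ i) by case: (sets i).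
have X_conv i : convex_subset (X_ i) by apply: polyhedral_convex; case: (sets i).
have cX : compact X by exact: prod_set_compact.
have C0 : 0 <= opnorm C by exact: opnorm_ge0.
have diam0 : 0 <= ediam X.
  have [z Xz] := prod_set_nonempty X_ne.
  by apply: le_trans (le_ediam cX Xz Xz); rewrite subrr enorm0.
have Lx0 l : (l <= T)%N -> 0 < Lx l by move=> /curv[].
have Ly0 l : (l <= T)%N -> 0 < Ly l by move=> /curv[].
have LJ0 l : (l <= T)%N -> 0 < LJ l by move=> /LJL0[].
have L0 l : (l <= T)%N -> 0 < L l by move=> /LJL0[].
have Mx0 l : (l <= T)%N -> 0 < Mx l by move=> /gbounds[].
have My0 l : (l <= T)%N -> 0 < My l by move=> /gbounds[].
have lam_ge0 := ltW lam0; have p_ge0 := ltW p0.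
pose hz := start kappa T.+1.
pose alf l k := alpha xs C f g X (t l) (start kappa l + k * B)%N.
pose bet l k := beta xs B K (start kappa l + k * B)%N.
have x_in k : (k <= hz)%N -> X (xtrue xs k).
  exact: (xtrue_in X_ne X_cpt run).
have end_phase l : (l <= T)%N -> (start kappa l + r l * B)%N = start kappa l.+1.
  by move=> /ticks[_ kE]; rewrite startS kE.
have r0 l : (l <= T)%N -> (0 < r l)%N.
  by move=> /ticks[k1 kE]; move: k1; rewrite kE; case: (r l).
have in_hz l k : (l <= T)%N -> (k <= r l)%N -> (start kappa l + k * B <= hz)%N.
  move=> lT kr; apply: leq_trans (start_le_horizon kappa lT).
  by rewrite -end_phase// leq_add2l leq_mul2r kr orbT.
have xopt_in l : (l <= T)%N -> argmin_set (fun z => J f g z (C *m z) (t l)) X (xstar C X f g (t l)).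
  by move=> lT; have [[? _ _] [? _ _] _ _] := smooth l lT; exact: xstar_argmin.
have s_le k : (k < hz)%N -> enorm (sstep xs K k) <= ediam X.
  move=> kT; rewrite (_ : sstep xs K k = xtrue xs k.+1 - xtrue xs k).
    by apply: le_ediam => //; [exact: x_in|exact: x_in (ltnW kT)].
  by rewrite (xtrueS run kT) addrC addKr.
have beta_le k : (k <= hz)%N -> beta xs B K k <= B%:R * ediam X ^+ 2.
  move=> kT; rewrite /beta; apply: (@le_trans _ _ (\sum_(k - B <= j < k) ediam X ^+ 2)).
    apply: ler_sum_nat => j /andP[_ jk].
    by rewrite ler_pXn2r ?nnegrE ?enorm_ge0// s_le// (leq_trans jk).
  rewrite sumr_const_nat -[leLHS]mulr_natl ler_wpM2r ?sqr_ge0// ler_nat.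
  by rewrite leq_subLR addnC -leq_subLR.
have J_lip l z w : (l <= T)%N -> X z -> X w ->
    `|J f g z (C *m z) (t l) - J f g w (C *m w) (t l)| <= LJ l * (1 + opnorm C) * enorm (z - w).
  move=> lT Xz Xw.
  have [h _] := lipJ l lT z w _ _ Xz Xw (ex_intro2 _ _ z Xz erefl) (ex_intro2 _ _ w Xw erefl).
  apply: (le_trans h); rewrite -mulrA ler_wpM2l ?(ltW (LJ0 _ lT))//.
  apply: (le_trans (enorm_col_mx _ _)); rewrite mulrDl mul1r lerD2l -mulmxBr.
  exact: enorm_mulmx.
have rho_b l : (l <= T)%N -> 3 / 4 <= rho P l < 1.
  move=> lT; have /andP[g0 g1] := gam_bounds l lT.
  exact: (rho_bounds (P := P) N0 C0 lam_ge0 (Lx0 _ lT) (Ly0 _ lT) (L0 _ lT) g0 g1).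
have a0 l : (l <= T)%N -> 0 <= al P l.
  exact: (al_ge0 (P := P) N0 B0 C0 diam0 lam_ge0 Lx0 Ly0 L0 LJ0 Mx0 My0 Lt0 Delta0
    sigma0 step_bound gam_bounds).
have b_ge l : (l <= T)%N -> B%:R * ediam X ^+ 2 <= bl P l.
  exact: (Bdiam_le_bl (P := P) N0 B0 C0 lam_ge0 Lx0 Ly0 L0 step_bound gam_bounds).
have b0 l : (l <= T)%N -> 0 <= bl P l.
  by move=> lT; apply: le_trans (b_ge l lT); rewrite mulr_ge0// sqr_ge0.
have alpha_beta l : (l <= T)%N -> alf l 0%N + El P l * bet l 0%N <= al P l ->
    forall k, (k < r l)%N ->
      alf l k.+1 <= al P l * rho P l ^+ k /\ bet l k.+1 <= bl P l * rho P l ^+ k.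
  move=> lT init; have /andP[r34 r1] := rho_b l lT; have rh0 : 0 <= rho P l by lra.
  have /andP[g0 g1] := gam_bounds l lT.
  have [diam_eq0|diam_neq0] := eqVneq (ediam X) 0.
    (* a single feasible point: nothing moves and the gap is zero *)
    move=> k kr; split.
      apply: (@le_trans _ _ 0); last by rewrite mulr_ge0 ?a0 ?exprn_ge0.
      have xk : X (xtrue xs (start kappa l + k.+1 * B)%N) by apply: x_in; exact: in_hz.
      have xo := (xopt_in l lT).1.
      apply: le_trans (ler_norm _) _; apply: (le_trans (J_lip l _ _ lT xk xo)).
      rewrite mulr_ge0_le0//; first by rewrite mulr_ge0 ?(ltW (LJ0 l lT))// addr_ge0.
      by rewrite -diam_eq0; exact: le_ediam.
    apply: (@le_trans _ _ 0); last by rewrite mulr_ge0 ?b0 ?exprn_ge0.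
    apply: le_trans (beta_le _ (in_hz l k.+1 lT kr)) _.
    by rewrite diam_eq0 expr2 mul0r mulr0.
  have diam_gt0 : 0 < ediam X by rewrite lt_def diam_neq0.
  have bl_gt0 : 0 < bl P l.
    by apply: lt_le_trans (b_ge l lT); rewrite mulr_gt0 ?exprn_gt0// ltr0n.
  have Q_le := Q_bl_le_al (P := P) N0 B0 C0 diam0 lam_ge0 Lx0 Ly0 L0 LJ0 Mx0 My0
    Lt0 Delta0 sigma0 step_bound gam_bounds lT.
  have [margin _] := contraction_margin (P := P) N0 B0 C0 lam_ge0 (Lx0 l lT) (Ly0 l lT)
    (L0 l lT) (step_bound l lT) g0 g1 bl_gt0 Q_le.
  have small := step_curvature_small (P := P) N0 B0 C0 lam_ge0 (Lx0 l lT) (Ly0 l lT)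
    (L0 l lT) (step_bound l lT) g0 g1 bl_gt0 Q_le.
  have E1 := El_ge1 (P := P) N0 B0 (Lx0 l lT) (Ly0 l lT) (step_bound l lT).
  have gam2 : gamma l <= 2^-1 by apply/ltW; exact: (gam_lt_half (P := P) g1).
  have D01 : 0 < Dl P l <= 1.
    rewrite (Dl_gt0 (P := P) C0 (Lx0 l lT) (Ly0 l lT) g1) ltW//.
    exact: (Dl_lt1 (P := P) C0 (Lx0 l lT) (Ly0 l lT) g0).
  have [[f_diff _ _] [g_diff _ _] f_conv g_conv] := smooth l lT.
  have [_ _ f_lip g_lip] := lips l lT.
  apply: (phase_decay B0 X_ne X_cpt X_conv PA run lT p_ge0 (ltW (Lx0 l lT)) (ltW (Ly0 l lT))
    f_diff g_diff f_conv g_conv f_lip g_lip g0 _ (error_bound l lT) lam_ge0 _ gam2 D01 _ small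
    (Fl_ge (P := P) N0 C0 lam_ge0 (Lx0 l lT) (Ly0 l lT) (L0 l lT))
    (descent_coefficient (P := P) N0 C0 (Lx0 l lT) (Ly0 l lT) g0) N0
    (El_ge (P := P) N0 (Ly0 l lT)) rh0 margin init).
  - lra.
  - by rewrite end_phase.
  - lra.
  - by apply: le_trans (b_ge l lT); apply: beta_le; apply: in_hz => //; exact: r0.
(* al l.+1 dominates the final bound for objective l plus the drift of the objective
   and of its minimizer plus E times the largest possible beta *)
have init l : (l <= T)%N -> alf l 0%N + El P l * bet l 0%N <= al P l.
  elim: l => [|l ih] lT.
    have -> : bet 0%N 0%N = 0 by rewrite /bet /start big_ord0 /beta big_geq.
    rewrite mulr0 addr0; apply: le_trans (al0_ge P).
    have x0 : X (xtrue xs (start kappa 0 + 0 * B)%N) by apply: x_in; exact: in_hz.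
    have xo := (xopt_in 0%N lT).1.
    apply: le_trans (ler_norm _) _; apply: (le_trans (J_lip _ _ _ lT x0 xo)).
    rewrite ler_wpM2l ?mulr_ge0 ?addr_ge0 ?(ltW (LJ0 _ lT))//; exact: le_ediam.
  have lT' := ltnW lT.
  apply: le_trans (alS_ge_El (P := P) N0 B0 C0 diam0 lam_ge0 Lx0 Ly0 L0 LJ0 Mx0 My0
    Lt0 Delta0 sigma0 step_bound gam_bounds lT).
  have startE : (start kappa l.+1 + 0 * B = start kappa l + r l * B)%N.
    by rewrite addn0 end_phase.
  apply: lerD; last first.
    have E1 := El_ge1 (P := P) N0 B0 (Lx0 _ lT) (Ly0 _ lT) (step_bound _ lT).
    by rewrite ler_wpM2l//; [lra|apply: beta_le; exact: in_hz].
  have prev : alf l (r l) <= al P l * rho P l ^+ (r l - 1)%N.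
    have := alpha_beta l lT' (ih lT') (r l - 1)%N.
    by rewrite subn1 (prednK (r0 l lT')) => -[].
  have [drift J_drift t_drift] := variation l lT.
  rewrite /alf /alpha startE -/(ytrue _ _ _) in prev *.
  set z := xtrue xs _ in prev *.
  have Xz : X z by apply: x_in; exact: in_hz.
  have [xo _] := xopt_in l lT'; have [xo' _] := xopt_in l.+1 lT.
  set w := xstar C X f g (t l) in xo prev drift; set w' := xstar C X f g (t l.+1) in xo' drift *.
  have LtD : Lt * `|(t l.+1)%:R - (t l)%:R| <= Lt * Delta by rewrite ler_wpM2l// ltW.
  have Yz v : X v -> Y (C *m v) by move=> Xv; exists v.
  have h1 := le_trans (J_drift z (C *m z) Xz (Yz z Xz)) LtD.
  have h2 := le_trans (J_drift w (C *m w) xo (Yz w xo)) LtD.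
  have h3 := J_lip l.+1 w w' lT xo xo'.
  have h4 : LJ l.+1 * (1 + opnorm C) * enorm (w - w') <= LJ l.+1 * sigma l.+1 * (1 + opnorm C).
    rewrite mulrAC ler_wpM2r ?addr_ge0// ler_wpM2l ?(ltW (LJ0 _ lT))//.
    by rewrite enormBC.
  move: prev h1 h2 h3 h4; rewrite /ystar -/w -/w' /ytrue -/z /= !ler_norml.
  move=> prev /andP[_ h1] /andP[h2 _] /andP[_ h3] h4; lra.
move=> l lT.
have /andP[r34 r1] := rho_b l lT.
have rk : ((r l - 1).+1 = r l)%N by rewrite subn1 (prednK (r0 l lT)).
have kr : (r l - 1 < r l)%N by rewrite rk.
have [al_le be_le] := alpha_beta l lT (init l lT) _ kr.
rewrite rk in al_le be_le.
split=> //; first by apply/andP; split; lra.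
have prev : bet l (r l - 1)%N <= bl P l * rho P l ^+ (r l - 1 - 1)%N.
  case E : (r l - 1)%N => [|k].
    by rewrite mulr1; apply: le_trans (b_ge l lT); apply: beta_le; exact: in_hz.
  have k_r : (k < r l)%N by rewrite -rk E leqW.
  by rewrite subn1; have [] := alpha_beta l lT (init l lT) k k_r.
have lastE : (start kappa l + (r l - 1) * B + B = start kappa l + r l * B)%N.
  by rewrite -addnA -mulSnr rk.
rewrite -lastE; apply: le_trans (delta_le B0 PA run _) _.
  by rewrite lastE; exact: in_hz.
rewrite lastE /dl /=.
have rb : 3 / 4 <= rho P l <= 1 by rewrite r34 ltW.
have rate := two_window_rate B0 rb (b0 l lT) prev be_le.
have Nm : (N <= \sum_i m_ i)%N.
  by rewrite -[leqLHS]card_ord -sum1_card; apply: leq_sum => i _.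
rewrite (_ : B%:R ^+ 2 * _ * opnorm C ^+ 2 * bl P l * _ = (\sum_i m_ i)%:R *
  (opnorm C ^+ 2 * (B%:R ^+ 2 * (bl P l * rho P l ^+ (r l - 1)%N)))); last by ring.
rewrite ler_pM ?ler_nat//.
  by rewrite !mulr_ge0 ?sqr_ge0// addr_ge0// sumr_ge0// => j _; exact: sqr_ge0.
by rewrite mulrAC [leLHS]mulrC ler_wpM2l ?sqr_ge0//; exact: rate.
Qed.
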